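(* (1) For every prime $p$, the meromorphic function $Z_p(X+Y,1;s)$ has a non-real pole (hence at least two non-real poles) on its axis of absolute convergence $\{s\in\mathbb{C} : \operatorname{Re}(s) = \theta_p\}$. (2) The meromorphic function $Z_2(X+2Y,1;s)$ has a non-real pole (hence at least two non-real poles) on its axis of absolute convergence $\{s\in\mathbb{C} : \operatorname{Re}(s) = \theta_2\}$.
   Context: Let $\mathbb{N}_0$ be the set of non-negative integers. For a prime $p$, let $\mathrm{Pas}(p)=\{(m,n)\in\mathbb{N}_0\times\mathbb{N}_0 : m\ge n,\ \binom{m}{n}\not\equiv 0 \pmod p\}$ and $\theta_p=\log\frac{p(p+1)}{2}/\log p$. For a non-constant polynomial $P\in\mathbb{R}[X,Y]$ of degree $d$, let $P_d$ be its homogeneous part of degree $d$; $P$ is called $\mathcal{T}$-elliptic if $P_d(x,y)>0$ for every $(x,y)\in\mathbb{R}^2\setminus\{(0,0)\}$ with $x\ge y\ge 0$. For $\mathcal{T}$-elliptic $P$ (such as $X+Y$ and $X+2Y$), the zeta function $$Z_p(P,1;s)=\sum_{(m,n)\in \mathrm{Pas}(p),\ P(m,n)\neq 0}\frac{1}{P(m,n)^{s/\deg P}}$$ is defined by this series for $s\in\mathbb{C}$ with sufficiently large real part, and it is known (Essouabri) to have a meromorphic continuation to the whole complex plane; $Z_p(P,1;s)$ also denotes this continuation. The axis of absolute convergence is the vertical line in $\mathbb{C}$ through the abscissa of absolute convergence of the series. *)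

(* Defs.v *)
From Stdlib Require Import Reals.
From Coquelicot Require Import Coquelicot.
From mathcomp Require Import all_boot all_algebra Rstruct.
From mathcomp.multinomials Require mpoly.

Set Implicit Arguments.
Unset Strict Implicit.
Unset Printing Implicit Defensive.

(* MathComp takes the key [%R] for [ring_scope]. *)
Delimit Scope R_scope with coqR.

Definition Pas (p m n : nat) : bool := ((n <= m) && ~~ (p %| 'C(m, n)))%N.

Definition theta (p : nat) : R :=
  (ln (INR p * (INR p + 1) / 2) / ln (INR p))%coqR.

Section Bipoly.
Import mpoly.
Local Open Scope ring_scope.

Definition bipoly : Type := {mpoly R[2]}.

Definition X_add_Y : bipoly := 'X_(ord0 : 'I_2) + 'X_(ord_max : 'I_2).

Definition X_add_2Y : bipoly :=
  'X_(ord0 : 'I_2) + 2%:R *: 'X_(ord_max : 'I_2).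

(* Total degree, for a nonzero polynomial. *)
Definition bideg (P : bipoly) : nat := (msize P).-1.

Definition bieval (P : bipoly) (m n : nat) : R :=
  meval (tnth [tuple INR m; INR n]) P.

End Bipoly.

Section Complex.
Local Open Scope C_scope.

Definition cexp (z : C) : C :=
  ((exp (Re z) * cos (Im z))%coqR, (exp (Re z) * sin (Im z))%coqR).

(* Principal logarithm of a nonzero real number; the negative case matters only
   for the finitely many negative values a T-elliptic polynomial may take. *)
Definition clog (x : R) : C := (ln (Rabs x), if Rlt_dec x 0 then PI else 0%coqR).

Definition rcpow (x : R) (z : C) : C := cexp (z * clog x).

Definition analytic_at (f : C -> C) (z0 : C) : Prop :=
  exists (a : nat -> C) (r : R), (0 < r)%coqR /\
    forall z : C, (Cmod (z - z0) < r)%coqR ->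
      @is_pseries C_AbsRing C_NormedModule a (z - z0) (f z).

(* [f z = g z / (z - z0) ^ n] on a punctured neighbourhood of [z0]; the value
   [f z0] is irrelevant, so a meromorphic function is a total function [C -> C]
   with arbitrary values at its poles. *)
Definition quotient_near (f g : C -> C) (z0 : C) (n : nat) : Prop :=
  exists r : R, (0 < r)%coqR /\
    forall z : C, z <> z0 -> (Cmod (z - z0) < r)%coqR ->
      f z = g z / Cpow (z - z0) n.

Definition meromorphic (f : C -> C) : Prop :=
  forall z0 : C, exists (n : nat) (g : C -> C),
    analytic_at g z0 /\ quotient_near f g z0 n.

Definition pole (f : C -> C) (z0 : C) : Prop :=
  exists (n : nat) (g : C -> C),
    [/\ n <> 0%N, analytic_at g z0, g z0 <> 0 & quotient_near f g z0 n].

Definition nonreal (s : C) : Prop := Im s <> 0%coqR.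

Definition zeta_term (p : nat) (P : bipoly) (s : C) (m n : nat) : C :=
  let v := bieval P m n in
  if Pas p m n && (v != 0)%R then / rcpow v (s / INR (bideg P)) else 0.

(* As [n <= m] on [Pas p], the double series is the series over [m] of the
   finite sums over [n <= m]; [zeta_acv] is the same with absolute values, so it
   expresses summability of the whole family. *)
Definition zeta_series (p : nat) (P : bipoly) (s z : C) : Prop :=
  @is_series C_AbsRing C_NormedModule
    (fun m => sum_n (fun n => zeta_term p P s m n) m) z.

Definition zeta_acv (p : nat) (P : bipoly) (s : C) : Prop :=
  @ex_series R_AbsRing R_NormedModule
    (fun m => sum_n (fun n => Cmod (zeta_term p P s m n)) m).

Definition abscissa (p : nat) (P : bipoly) : Rbar :=
  Glb_Rbar (fun sigma : R => zeta_acv p P (RtoC sigma)).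

Definition on_axis (p : nat) (P : bipoly) (s : C) : Prop :=
  Rbar.Finite (Re s) = abscissa p P.

(* By the identity theorem such a [Z] is unique up to its values at isolated
   points. *)
Definition zeta_continuation (p : nat) (P : bipoly) (Z : C -> C) : Prop :=
  meromorphic Z /\
  exists sigma0 : R, forall s : C,
    (sigma0 < Re s)%coqR -> zeta_series p P s (Z s).

End Complex.

(* Main.v *)
(* Write [v = m + c n] for the value at [(m, n)] of [X + c Y], [h = c + 1] and
   [P = p^k].  By Lucas' theorem membership in [Pas p] is read off the base [p]
   digits.  Hence [sum v^(-s)] over [Pas p] converges exactly for
   [s > theta p], and if [(m, n)] lies in [Pas p] with [h P <= v < (h + 1) P],
   then so does [(m - P, n)] or [(m - P, n - P)], of value [v - P],
   respectively [v - h P].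

   The candidate poles are [theta p + i k w] with [w = 2 pi / ln p] and [k <> 0].
   If none of them is a pole, the series stays bounded when [s] tends to them
   from the right, so that for [e -> 0+] the masses [v^(- theta p - e)] become
   equidistributed in the variable [ln v] modulo [ln p]: by linearity,
   [sum v^(- theta p - e) cos^(2n) (w (ln v - ln t) / 2)] is asymptotic to
   [a_n sum v^(- theta p - e)], with [a_n] the mean value of [cos^(2n)], for
   every [t].  The masses around [t P] thus have a density proportional to
   [t^(theta p - 1)] in [t], and for [h < t < h + 1] the shift property gives
   [t^(theta p - 1) <= (t - 1)^(theta p - 1) + (t - h)^(theta p - 1)].  This
   fails for [t] close to [h], as [theta p > 1].  The argument is carried out
   with the kernels [cos^(2n)] themselves: [a_n ~ 1 / sqrt (pi n)], and
   translating a kernel by [s] turns the one at [t] into the one at [t - s] with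
   [n] replaced by about [n ((t - s) / t)^2].

   The meromorphic continuation only enters through its restrictions to
   horizontal lines, where it agrees with the series to the right of
   [theta p]. *)

Require Import Defs.
From Stdlib Require Import Reals Lra Psatz.
From Coquelicot Require Import Coquelicot.
From mathcomp Require Import all_boot all_algebra Rstruct.
From mathcomp Require Import zify.
From mathcomp.multinomials Require mpoly.

Set Implicit Arguments.
Unset Strict Implicit.
Unset Printing Implicit Defensive.

Local Open Scope R_scope.

Lemma INR_addn (m n : nat) : INR (m + n)%N = INR m + INR n.
Proof. by rewrite -plusE plus_INR. Qed.

Lemma INR_muln (m n : nat) : INR (m * n)%N = INR m * INR n.
Proof. by rewrite -multE mult_INR. Qed.

(** * Finite sums *)

Fixpoint rsum (f : nat -> R) (n : nat) : R :=
  if n is k.+1 then rsum f k + f k else 0.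

Lemma sum_n_rsum (f : nat -> R) (n : nat) : sum_n f n = rsum f n.+1.
Proof.
elim: n => [|n IH]; first by rewrite sum_O /=; ring.
by rewrite sum_Sn IH.
Qed.

Lemma rsum_ext (f g : nat -> R) (n : nat) :
  (forall i, (i < n)%N -> f i = g i) -> rsum f n = rsum g n.
Proof.
elim: n => [//|n IH] H /=.
by rewrite IH ?H // => i Hi; apply: H; exact: ltnW.
Qed.

Lemma rsum_le (f g : nat -> R) (n : nat) :
  (forall i, (i < n)%N -> f i <= g i) -> rsum f n <= rsum g n.
Proof.
elim: n => [|n IH] H /=; first lra.
apply: Rplus_le_compat; last exact: H.
by apply: IH => i Hi; apply: H; exact: ltnW.
Qed.

Lemma rsum_plus (f g : nat -> R) (n : nat) :
  rsum (fun i => f i + g i) n = rsum f n + rsum g n.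
Proof. by elim: n => [|n /= ->] /=; ring. Qed.

Lemma rsum_scal (c : R) (f : nat -> R) (n : nat) :
  rsum (fun i => c * f i) n = c * rsum f n.
Proof. by elim: n => [|n /= ->] /=; ring. Qed.

Lemma rsum_const (c : R) (n : nat) : rsum (fun=> c) n = INR n * c.
Proof. by elim: n => [|n IH]; rewrite ?S_INR /= ?IH; ring. Qed.

Lemma rsum_ge0 (f : nat -> R) (n : nat) :
  (forall i, (i < n)%N -> 0 <= f i) -> 0 <= rsum f n.
Proof.
move=> H; have := @rsum_le (fun=> 0) f n H.
by rewrite rsum_const Rmult_0_r.
Qed.

Lemma rsum_abs (f : nat -> R) (n : nat) :
  Rabs (rsum f n) <= rsum (fun i => Rabs (f i)) n.
Proof.
elim: n => [|n IH] /=; first by rewrite Rabs_R0; lra.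
by apply: Rle_trans (Rabs_triang _ _) _; lra.
Qed.

Lemma rsum_cat (f : nat -> R) (m n : nat) :
  rsum f (m + n) = rsum f m + rsum (fun i => f (m + i)%N) n.
Proof.
elim: n => [|n IH] /=; first by rewrite addn0; ring.
by rewrite addnS /= IH; ring.
Qed.

Lemma rsum_incr (f : nat -> R) (m n : nat) :
  (m <= n)%N -> (forall i, 0 <= f i) -> rsum f m <= rsum f n.
Proof.
move=> mn H; rewrite -(subnKC mn) rsum_cat.
have := @rsum_ge0 (fun i => f (m + i)%N) (n - m)%N (fun i _ => H _).
lra.
Qed.

Lemma rsum_exchange (f : nat -> nat -> R) (m n : nat) :
  rsum (fun i => rsum (f i) n) m = rsum (fun j => rsum (f^~ j) m) n.
Proof.
elim: m => [|m IH] /=; first by rewrite rsum_const; ring.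
by rewrite IH -rsum_plus.
Qed.

Lemma rsum_mul (f : nat -> R) (p n : nat) :
  rsum f (p * n) = rsum (fun i => rsum (fun a => f (p * i + a)%N) p) n.
Proof.
elim: n => [|n IH] /=; first by rewrite muln0.
by rewrite mulnS addnC rsum_cat IH.
Qed.

Lemma rsum_widen (f : nat -> R) (m n : nat) :
  (m <= n)%N -> (forall i, (m <= i < n)%N -> f i = 0) -> rsum f n = rsum f m.
Proof.
move=> mn H; rewrite -(subnKC mn) rsum_cat.
rewrite (@rsum_ext (fun i => f (m + i)%N) (fun=> 0)).
  by rewrite rsum_const; ring.
by move=> i Hi; apply: H; lia.
Qed.

(** A translation is injective, so the translated sum only loses terms. In [near_shift_sum] this
    bounds how often a translated point of [Pas p] is charged. *)
Lemma rsum_shift_le (f : nat -> R) (k n : nat) : (forall i, 0 <= f i) ->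
  rsum (fun i => if (k <= i)%N then f (i - k)%N else 0) n <= rsum f n.
Proof.
move=> H.
have [kn|nk] := leqP k n; last first.
  rewrite (@rsum_ext _ (fun=> 0)).
    by rewrite rsum_const Rmult_0_r; exact: rsum_ge0.
  by move=> i Hi; rewrite leqNgt (ltn_trans Hi nk).
rewrite -[n in X in X <= _](subnKC kn) rsum_cat.
rewrite (@rsum_ext _ (fun=> 0) k); last by move=> i Hi; rewrite leqNgt Hi.
rewrite (@rsum_ext (fun i => if (k <= k + i)%N then _ else 0) f); last first.
  by move=> i _; rewrite leq_addr addKn.
rewrite rsum_const Rmult_0_r Rplus_0_l.
by apply: rsum_incr => //; exact: leq_subr.
Qed.

Lemma rsum_single (a : R) (i n : nat) : (i < n)%N ->
  rsum (fun k => if k == i then a else 0) n = a.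
Proof.
move=> ni; rewrite (@rsum_widen _ i.+1) //=; last first.
  by move=> k /andP [ik _]; case: eqP ik => // ->; rewrite ltnn.
rewrite eqxx (@rsum_ext _ (fun=> 0)) ?rsum_const; first ring.
by move=> k ki; case: eqP ki => // ->; rewrite ltnn.
Qed.

Lemma rsum_ge_term (f : nat -> R) (i n : nat) : (i < n)%N ->
  (forall k, 0 <= f k) -> f i <= rsum f n.
Proof.
move=> ni f0; apply: Rle_trans (rsum_incr ni f0).
by have := @rsum_ge0 f i (fun k _ => f0 k); rewrite /=; lra.
Qed.

(** * Series *)

(** A bound along cofinally many partial sums suffices for nonnegative terms; the estimates below
    are only made at the indices [p ^ k]. *)
Lemma ex_series_bounded (f : nat -> R) (M : R) :
  (forall i, 0 <= f i) -> (forall n, exists2 m, (n <= m)%N & rsum f m <= M) ->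
  ex_series f.
Proof.
move=> H0 HM.
have [l Hl] : ex_finite_lim_seq (sum_n f).
  apply: (@ex_finite_lim_seq_incr _ M) => n; rewrite !sum_n_rsum.
    by have := H0 n.+1; rewrite /=; lra.
  have [m nm Hm] := HM n.+1.
  by apply: Rle_trans Hm; exact: rsum_incr.
by exists l.
Qed.

Lemma rsum_le_Series (f : nat -> R) (n : nat) :
  (forall i, 0 <= f i) -> ex_series f -> rsum f n <= Series f.
Proof.
move=> H0 /Series_correct Hf.
have H : is_lim_seq (sum_n f) (Series f) by [].
have := @is_lim_seq_incr_compare _ _ H; rewrite /= => K.
apply: Rle_trans (K _ n).
  by rewrite sum_n_rsum /=; have := H0 n; lra.
by move=> k; rewrite !sum_n_rsum /=; have := H0 k.+1; lra.
Qed.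

Lemma Series_le_bound (f : nat -> R) (M : R) :
  ex_series f -> (forall n, rsum f n <= M) -> Series f <= M.
Proof.
move=> /Series_correct Hf HM.
have H : is_lim_seq (sum_n f) (Series f) by [].
have := @is_lim_seq_le _ (fun=> M) _ M _ H (is_lim_seq_const M).
by apply=> n; rewrite sum_n_rsum.
Qed.

Lemma is_series_rsum (f : nat -> R) (l : R) :
  is_series f l <-> is_lim_seq (fun n => rsum f n.+1) l.
Proof.
rewrite -[is_series f l]/(is_lim_seq (sum_n f) l).
by split; apply: is_lim_seq_ext => n; rewrite sum_n_rsum.
Qed.

Lemma is_series_0 : is_series (fun=> 0) 0.
Proof.
apply/is_series_rsum; apply: (is_lim_seq_ext (fun=> 0)).
  by move=> n; rewrite rsum_const; ring.
exact: is_lim_seq_const.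
Qed.

Lemma Series_rsum (f : nat -> nat -> R) (n : nat) :
  (forall i, ex_series (f i)) ->
  ex_series (fun m => rsum (f^~ m) n) /\
  Series (fun m => rsum (f^~ m) n) = rsum (fun i => Series (f i)) n.
Proof.
move=> H; elim: n => [|n [E1 E2]] /=.
  by split; [exists 0; exact: is_series_0 | exact: is_series_unique is_series_0].
split; first exact: (@ex_series_plus R_AbsRing R_NormedModule).
by rewrite Series_plus ?E2.
Qed.

Lemma ex_series_dominated (f g : nat -> R) :
  (forall i, Rabs (f i) <= g i) -> ex_series g -> ex_series f.
Proof. exact: (@ex_series_le R_AbsRing R_CompleteNormedModule). Qed.

Lemma Series_dominated_tail (f g : nat -> R) (M : nat) :
  (forall i, 0 <= f i <= g i) -> ex_series g ->
  Series f <= rsum f M + (Series g - rsum g M).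
Proof.
move=> H Hg.
have H0 i : 0 <= g i by have := H i; lra.
have Hf : ex_series f.
  apply: ex_series_dominated Hg => i; rewrite Rabs_right; have := H i; lra.
apply: Series_le_bound => // n.
have Hd : forall k, rsum f (M + k) - rsum f M <= rsum g (M + k) - rsum g M.
  move=> k; rewrite !rsum_cat.
  have := @rsum_le (fun i => f (M + i)%N) (fun i => g (M + i)%N) k
    (fun i _ => proj2 (H _)).
  lra.
have := rsum_le_Series (M + n) H0 Hg; have := Hd n.
have := @rsum_incr f n (M + n) (leq_addl _ _) (fun i => proj1 (H i)).
lra.
Qed.

(** Dominated convergence for series: the differences [v k m] are at most [2 * B m], so a tail is
    small uniformly in [k], and the remaining finite head tends to 0. *)
Lemma Series_limit_dominated (u : nat -> nat -> R) (l B : nat -> R) :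
  (forall k m, Rabs (u k m) <= B m) ->
  (forall m, is_lim_seq (u^~ m) (l m)) -> ex_series B ->
  is_lim_seq (fun k => Series (u k)) (Series l).
Proof.
move=> HB Hl EB.
have HlB m : Rabs (l m) <= B m.
  have := @is_lim_seq_le (fun k => Rabs (u k m)) (fun=> B m) (Rabs (l m)) (B m).
  apply => //; last exact: is_lim_seq_const.
  exact: (is_lim_seq_abs _ _ (Hl m)).
pose v k m := Rabs (u k m - l m).
have Hv k m : 0 <= v k m <= 2 * B m.
  split; first exact: Rabs_pos.
  rewrite /v; apply: Rle_trans (Rabs_triang _ _) _.
  rewrite Rabs_Ropp; have := HB k m; have := HlB m; lra.
have E2B : ex_series (fun m => 2 * B m).
  exact: (@ex_series_scal R_AbsRing R_NormedModule).
have Hfin M : is_lim_seq (fun k => rsum (v k) M) 0.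
  elim: M => [|M IH] /=; first exact: is_lim_seq_const.
  have Hx : is_lim_seq (v^~ M) 0.
    have := is_lim_seq_minus' _ _ _ _ (Hl M) (is_lim_seq_const (l M)).
    by rewrite Rminus_diag => /is_lim_seq_abs; rewrite /= Rabs_R0.
  by have := is_lim_seq_plus' _ _ _ _ IH Hx; rewrite Rplus_0_r.
apply/is_lim_seq_spec => eps.
have e3 : 0 < eps / 2 by have := cond_pos eps; lra.
have [M HM] : exists M, Series (fun m => 2 * B m) - rsum (fun m => 2 * B m) M < eps / 2.
  have /is_series_rsum/is_lim_seq_spec/(_ (mkposreal _ e3)) [M HM] :=
    Series_correct _ E2B.
  exists M.+1; move: (HM M (le_n _)); rewrite /=.
  by move=> /Rabs_def2; lra.
have /is_lim_seq_spec/(_ (mkposreal _ e3)) [K HK] := Hfin M.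
exists K => k kK.
have Hvk := Series_dominated_tail M (Hv k) E2B.
move: (HK k kK); rewrite /= Rminus_0_r => /Rabs_def2 [K1 _].
apply: (@Rle_lt_trans _ (Series (v k))); last lra.
rewrite -Series_minus.
- apply: Series_Rabs; apply: ex_series_dominated E2B => i.
  by rewrite Rabs_Rabsolu; exact: (proj2 (Hv k i)).
- exact: ex_series_dominated EB.
- exact: ex_series_dominated EB.
Qed.

(** Dominated convergence applied to the partial sums over [k] of each row, which [B] bounds
    uniformly. *)
Lemma Series_fubini (b : nat -> nat -> R) (B : nat -> R) :
  (forall m, ex_series (b m)) ->
  (forall m n, rsum (fun k => Rabs (b m k)) n <= B m) -> ex_series B ->
  is_series (fun k => Series (b^~ k)) (Series (fun m => Series (b m))).
Proof.
move=> Hb HB EB.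
have Hbk k : ex_series (b^~ k).
  apply: ex_series_dominated EB => m; apply: Rle_trans (HB m k.+1).
  have := @rsum_ge0 (fun k => Rabs (b m k)) k (fun i _ => Rabs_pos _).
  rewrite /=; lra.
have H := @Series_limit_dominated (fun k m => rsum (b m) k.+1)
  (fun m => Series (b m)) B _ _ EB.
apply/is_series_rsum; apply: is_lim_seq_ext (H _ _).
- move=> k.
  exact: (proj2 (@Series_rsum (fun k m => b m k) k.+1 Hbk)).
- by move=> k m; exact: Rle_trans (rsum_abs _ _) (HB m k.+1).
by move=> m; apply/is_series_rsum; exact: Series_correct.
Qed.

(** * Power series on the real line *)

Lemma ex_pseries_radius (a : nat -> R) (x : R) :
  ex_pseries a x -> Rbar_le (Rabs x) (CV_radius a).
Proof.
move=> H; apply: Rbar_not_lt_le => /CV_disk_outside; apply.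
have H' : ex_series (fun n => a n * x ^ n).
  by apply: ex_series_ext H => n; rewrite pow_n_pow /scal /= /mult /=; ring.
exact: ex_series_lim_0.
Qed.

(** The sum is continuous at 0, where its value is [a 0], and it has zeros arbitrarily close to
    0. *)
Lemma pseries_head_zero (a : nat -> R) :
  (forall d, 0 < d -> exists t, [/\ t <> 0, Rabs t < d & is_pseries a t 0]) ->
  a 0%N = 0.
Proof.
move=> H; have [t0 [t00 _ Ht0]] := H 1 Rlt_0_1.
have Hr : Rbar_lt (Rabs 0) (CV_radius a).
  apply: (@Rbar_lt_le_trans _ (Rabs t0)).
    by rewrite Rabs_R0 /=; exact: Rabs_pos_lt.
  by apply: ex_pseries_radius; exists 0.
have Hc := PSeries_continuity _ _ Hr.
case: (Req_dec (a 0%N) 0) => // Ha.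
have [d [d0 Hd]] := Hc _ (Rabs_pos_lt _ Ha).
have [t [t0' td Ht]] := H d d0.
have := Hd t; rewrite /dist /= /R_dist /D_x /no_cond (is_pseries_unique _ _ _ Ht).
rewrite PSeries_0 Rminus_0_r Rminus_0_l Rabs_Ropp => K.
have := K (conj (conj I (not_eq_sym t0')) td); lra.
Qed.

(** Identity theorem: once the head vanishes, dividing by [t] gives a series with the same nonzero
    zeros. *)
Lemma pseries_zero (a : nat -> R) :
  (forall d, 0 < d -> exists t, [/\ t <> 0, Rabs t < d & is_pseries a t 0]) ->
  forall k, a k = 0.
Proof.
move=> H k; elim: k a H => [|k IH] a H; first exact: pseries_head_zero.
apply: (IH (PS_decr_1 a)) => d d0.
have [t [t0 td Ht]] := H d d0.
exists t; split=> //.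
have := @is_pseries_decr_1 R_AbsRing R_NormedModule a t (/ t) 0 (Rinv_l _ t0) Ht.
rewrite (pseries_head_zero H) /scal /= /mult /= /plus /opp /=.
by have -> : / t * (0 + - 0) = 0 by ring.
Qed.

(* Restrictions to a horizontal line of functions that are meromorphic,
   respectively analytic, at a point of the line. *)
Definition line_meromorphic_at (z : R -> R) (t0 : R) : Prop :=
  exists (n : nat) (a : nat -> R) (r : R), 0 < r /\
    forall t, t <> 0 -> Rabs t < r -> is_pseries a t (t ^ n * z (t0 + t)).

Definition line_analytic_at (u : R -> R) (t0 : R) : Prop :=
  exists (a : nat -> R) (r : R), 0 < r /\
    forall t, Rabs t < r -> is_pseries a t (u (t0 + t)).

(** The centre is left out because a meromorphic function may take any value at an isolated
    point. *)
Definition punctured_eq (z u : R -> R) (t0 : R) : Prop :=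
  exists2 d, 0 < d & forall t, t <> 0 -> Rabs t < d -> z (t0 + t) = u (t0 + t).

(** After multiplication by [t ^ n] the difference [z - u] is a power series whose zeros accumulate
    at 0, so the identity theorem applies. *)
Lemma punctured_eq_local (z u : R -> R) (t0 : R) :
  line_meromorphic_at z t0 -> line_analytic_at u t0 ->
  (forall d, 0 < d ->
     exists t, [/\ t <> 0, Rabs t < d & z (t0 + t) = u (t0 + t)]) ->
  punctured_eq z u t0.
Proof.
move=> [n [a [ra [ra0 Ha]]]] [b [rb [rb0 Hb]]] H.
pose r := Rmin ra rb; have r0 : 0 < r by exact: Rmin_pos.
have rra : r <= ra by exact: Rmin_l.
have rrb : r <= rb by exact: Rmin_r.
pose c := PS_minus a (PS_incr_n b n).
have Hc t : t <> 0 -> Rabs t < r ->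
    is_pseries c t (t ^ n * (z (t0 + t) - u (t0 + t))).
  move=> t00 tr.
  have Hat : is_pseries a t (t ^ n * z (t0 + t)) by apply: Ha => //; lra.
  have Hbt : is_pseries b t (u (t0 + t)) by apply: Hb; lra.
  have := is_pseries_minus _ _ _ _ _ Hat (is_pseries_incr_n _ n _ _ Hbt).
  rewrite pow_n_pow /plus /opp /scal /= /mult /=.
  by rewrite Rmult_minus_distr_l.
have c0 : forall k, c k = 0.
  apply: pseries_zero => d d0.
  have [t [t00 td Ht]] := H (Rmin d r) (Rmin_pos _ _ d0 r0).
  have dd := Rmin_l d r; have dr := Rmin_r d r.
  exists t; split=> //; first lra.
  have := Hc t t00; rewrite Ht Rminus_diag Rmult_0_r; apply; lra.
exists r => // t t00 tr.
have : PSeries c t = 0.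
  rewrite /PSeries -(is_series_unique _ _ is_series_0).
  by apply: Series_ext => k; rewrite c0; ring.
rewrite (is_pseries_unique _ _ _ (Hc t t00 tr)) => /Rmult_integral [K|K]; last lra.
by have := pow_nonzero _ n t00.
Qed.

(* If the infimum [t1] of the points beyond which [z] and [u] agree were larger
   than [t0], then they would agree around [t1] too. *)
Lemma punctured_eq_continuation (z u : R -> R) (t0 s0 : R) :
  (forall t, line_meromorphic_at z t) ->
  (forall t, t0 < t -> line_analytic_at u t) ->
  (forall t, s0 < t -> z t = u t) ->
  forall t, t0 < t -> punctured_eq z u t.
Proof.
move=> Hz Hu H0.
pose P t := forall t', t < t' -> t0 < t' -> punctured_eq z u t'.
have P_s0 : P s0.
  move=> t st _; exists (t - s0) => [|x _ /Rabs_def2 xt]; first lra.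
  by apply: H0; lra.
suff : P t0 by move=> HP t tt; exact: HP.
case: (Classical_Prop.classic (P t0)) => // nP.
(* The infimum [t1] is obtained as the opposite of a least upper bound. *)
have [b [Hub Hlb]] : {m | is_lub (fun x => P (- x)) m}.
  apply: completeness; last by exists (- s0); rewrite Ropp_involutive.
  exists (- t0) => x Px.
  have [//|xt] := Rle_lt_dec x (- t0).
  by case: nP => t tt _; apply: Px; lra.
pose t1 := - b.
have P_t1 : P t1.
  move=> t t1t t0t.
  have [x Px xt] : exists2 x, P (- x) & - t < x.
    apply: Classical_Prop.NNPP => nx.
    have : b <= - t; last by rewrite /t1 in t1t; lra.
    apply: Hlb => x Px; apply: Rnot_lt_le => xt; apply: nx; exists x => //.
  by apply: Px; lra.
have t1E : t1 = - b by [].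
clearbody t1; have t01 : t0 < t1.
  apply: Rnot_le_lt => t10; apply: nP => t tt _; apply: P_t1; lra.
have Ht1 : punctured_eq z u t1.
  apply: punctured_eq_local => [//||d d0]; first exact: Hu.
  have [e e0 He] : punctured_eq z u (t1 + d / 2) by apply: P_t1; lra.
  (* The agreement known around [t1 + d / 2] omits that point itself, hence the extra offset [x]. *)
  pose x := Rmin (d / 4) (e / 2).
  have x0 : 0 < x by apply: Rmin_pos; lra.
  have xd : x <= d / 4 by exact: Rmin_l.
  have xe : x <= e / 2 by exact: Rmin_r.
  exists (d / 2 + x); split; first lra.
    by rewrite Rabs_right; lra.
  rewrite -Rplus_assoc; apply: He; first lra.
  by rewrite Rabs_right; lra.
have [d d0 Hd] := Ht1.
(* This is [P (t1 - d)], against the minimality of [t1]. To the left of [t1] one takes balls that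
   avoid [t1]. *)
have : P (- (b + d)).
  move=> t tt t0t.
  have [tt1|tt1] := Rle_lt_dec t t1; last by apply: P_t1.
  have [tt1'|E] := Rle_lt_or_eq_dec _ _ tt1; last by rewrite E; exact: Ht1.
  pose e := Rmin (t1 - t) (t - (t1 - d)).
  have e1 : e <= t1 - t by exact: Rmin_l.
  have e2 : e <= t - (t1 - d) by exact: Rmin_r.
  have e0 : 0 < e by apply: Rmin_pos; lra.
  exists e => // x x0 /Rabs_def2 xe.
  have -> : t + x = t1 + (t + x - t1) by ring.
  by apply: Hd; [lra | apply: Rabs_def1; lra].
move=> /Hub; lra.
Qed.

(** * Powers of the cosine *)

Lemma rsum_recl (f : nat -> R) (n : nat) :
  rsum f n.+1 = f 0%N + rsum (fun i => f i.+1) n.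
Proof. by rewrite -add1n rsum_cat /=; congr (_ + _); ring. Qed.

(** Induction on [n]: multiplying by [2 * cos x] splits each cosine into two of neighbouring
    frequencies, and Pascal's rule collects the coefficients. *)
Lemma cos_pow_linearize (x : R) (n : nat) :
  cos x ^ n =
  / 2 ^ n * rsum (fun k => INR 'C(n, k) * cos ((INR n - 2 * INR k) * x)) n.+1.
Proof.
elim: n => [|n IH].
  rewrite /= Rmult_0_r Rminus_0_r Rmult_0_l cos_0; field.
rewrite -tech_pow_Rmult IH.
have H : 2 * cos x * rsum (fun k => INR 'C(n, k) * cos ((INR n - 2 * INR k) * x)) n.+1 =
    rsum (fun k => INR 'C(n, k) * cos ((INR n.+1 - 2 * INR k) * x)) n.+1 +
    rsum (fun k => INR 'C(n, k) * cos ((INR n.+1 - 2 * INR k.+1) * x)) n.+1.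
  rewrite -rsum_scal -rsum_plus; apply: rsum_ext => k _.
  have -> : (INR n.+1 - 2 * INR k) * x = (INR n - 2 * INR k) * x + x.
    by rewrite S_INR; ring.
  have -> : (INR n.+1 - 2 * INR k.+1) * x = (INR n - 2 * INR k) * x - x.
    by rewrite !S_INR; ring.
  by rewrite cos_plus cos_minus; ring.
have E : rsum (fun k => INR 'C(n.+1, k) * cos ((INR n.+1 - 2 * INR k) * x)) n.+2 =
    2 * cos x * rsum (fun k => INR 'C(n, k) * cos ((INR n - 2 * INR k) * x)) n.+1.
  rewrite H rsum_recl (@rsum_ext _ (fun k =>
    INR 'C(n, k.+1) * cos ((INR n.+1 - 2 * INR k.+1) * x) +
    INR 'C(n, k) * cos ((INR n.+1 - 2 * INR k.+1) * x))); last first.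
    by move=> k _; rewrite binS -plusE plus_INR; ring.
  rewrite rsum_plus -Rplus_assoc; congr (_ + _).
  rewrite [in RHS]rsum_recl !bin0; congr (_ + _).
  rewrite -[LHS]/(rsum _ n + INR 'C(n, n.+1) * _) bin_small //.
  by rewrite Rmult_0_l Rplus_0_r.
rewrite E -[2 ^ n.+1]tech_pow_Rmult; field.
by apply: pow_nonzero; lra.
Qed.

(* The mean value of [cos^(2n)] over a period. *)
Definition cos_mean (n : nat) : R := INR 'C(2 * n, n) / 4 ^ n.

Lemma cos_mean_gt0 (n : nat) : 0 < cos_mean n.
Proof.
apply: Rdiv_lt_0_compat; last by apply: pow_lt; lra.
by apply: (lt_INR 0); apply/ltP; rewrite bin_gt0; lia.
Qed.

Lemma cos_meanS (n : nat) :
  cos_mean n.+1 = cos_mean n * ((2 * INR n + 1) / (2 * INR n + 2)).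
Proof.
have E : (n.+1 * 'C(2 * n.+1, n.+1) = 2 * ((2 * n).+1 * 'C(2 * n, n)))%N.
  have E1 := mul_bin_diag (2 * n).+1 n.
  have E2 := mul_bin_diag (2 * n) n.
  have E3 : 'C((2 * n).+1, n) = 'C((2 * n).+1, n.+1).
    rewrite -(@bin_sub (2 * n).+1 n); last by lia.
    by congr 'C(_, _); lia.
  have E4 := mul_bin_diag (2 * n).+2.-1.+1 n.
  have -> : (2 * n.+1 = (2 * n).+2)%N by lia.
  rewrite -E4 /= E3; move: E1; rewrite /= => E1; lia.
have := congr1 INR E; rewrite !INR_muln !S_INR INR_muln /= => ER.
have n0 := pos_INR n.
have H4 : 4 ^ n <> 0 by apply: pow_nonzero; lra.
rewrite /cos_mean.
have -> : INR 'C(2 * n.+1, n.+1) =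
    (0 + 1 + 1) * (((1 + 1) * INR n + 1) * INR 'C(2 * n, n)) / (INR n + 1).
  rewrite -ER; field; lra.
rewrite -tech_pow_Rmult; field; split; lra.
Qed.

(** The monotonicity behind Wallis' product. It stands in for the asymptotics [1 / sqrt (pi n)], of
    which only the comparisons in the next two lemmas are used. *)
Lemma cos_mean_sqr_incr (m n : nat) : (m <= n)%N ->
  INR m * cos_mean m ^ 2 <= INR n * cos_mean n ^ 2.
Proof.
move=> mn; rewrite -(subnKC mn); elim: (n - m)%N => [|k IH].
  by rewrite addn0; lra.
apply: Rle_trans IH _; rewrite addnS cos_meanS S_INR.
set N := INR _; set a := cos_mean _.
have N0 : 0 <= N by exact: pos_INR.
have -> : (N + 1) * (a * ((2 * N + 1) / (2 * N + 2))) ^ 2 =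
  a ^ 2 * (N + / (4 * (N + 1))) by field; lra.
have : 0 < / (4 * (N + 1)) by apply: Rinv_0_lt_compat; lra.
have := pow2_ge_0 a; nra.
Qed.

Lemma cos_mean_le (m n : nat) (l : R) : (m <= n)%N -> 0 < l ->
  0 < INR m -> INR n <= l ^ 2 * INR m -> cos_mean m <= l * cos_mean n.
Proof.
move=> mn l0 m0 nlm; have H := cos_mean_sqr_incr mn.
have am := cos_mean_gt0 m; have an := cos_mean_gt0 n.
have [//|K] := Rle_lt_dec (cos_mean m) (l * cos_mean n).
have : (l * cos_mean n) ^ 2 < cos_mean m ^ 2.
  by have : 0 < l * cos_mean n by [exact: Rmult_lt_0_compat]; nra.
rewrite Rpow_mult_distr => K2.
have := Rmult_lt_compat_l _ _ _ m0 K2.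
have := pow2_ge_0 (cos_mean n); nra.
Qed.

(** Comparison with [n = 1], where the mean is [1 / 2]. Any polynomial lower bound will do against
    the geometric error [(r ^ n) ^ 2]. *)
Lemma cos_mean_ge (n : nat) : (0 < n)%N -> 1 <= 2 * INR n * cos_mean n.
Proof.
move=> n0; have := cos_mean_sqr_incr n0.
rewrite {1}/cos_mean muln1 bin1 /= => H.
have n1 : 1 <= INR n by apply: (le_INR 1); lia.
have an := cos_mean_gt0 n.
have [//|K] := Rle_lt_dec 1 (2 * INR n * cos_mean n).
nra.
Qed.

(* [(1 - S)^n <= exp (- n S)] and [T^m >= exp (- m (1 - T) / T)]. *)
Lemma pow_compare (S T : R) (m n : nat) : 0 <= S <= 1 -> 0 < T ->
  INR m * ((1 - T) / T) <= INR n * S -> (1 - S) ^ n <= T ^ m.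
Proof.
move=> S01 T0 H.
apply: (@Rle_trans _ (exp (- S) ^ n)).
  by apply: pow_incr; have := exp_ineq1_le (- S); lra.
apply: (@Rle_trans _ (exp (- ((1 - T) / T)) ^ m)); last first.
  apply: pow_incr; split; first exact: Rlt_le (exp_pos _).
  rewrite exp_Ropp -[X in _ <= X]Rinv_inv; apply: Rinv_le_contravar.
    exact: Rinv_0_lt_compat.
  have := exp_ineq1_le ((1 - T) / T).
  by have -> : 1 + (1 - T) / T = / T by field; lra.
have E k x : exp x ^ k = exp (INR k * x).
  elim: k => [|k IH]; first by rewrite /= Rmult_0_l exp_0.
  by rewrite -tech_pow_Rmult IH -exp_plus S_INR; congr exp; ring.
rewrite !E; have [K|K] : INR n * - S < INR m * - ((1 - T) / T) \/
  INR n * - S = INR m * - ((1 - T) / T) by lra.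
  by apply: Rlt_le; exact: exp_increasing.
by rewrite K; lra.
Qed.

(** Near [x0] the difference quotients of [F] and [G] lie within [e] of [f] and [g]; [e] is the
    solution of [s * (g + e) = f - e]. *)
Lemma derivable_compare (F G : R -> R) (x0 f g s : R) :
  derivable_pt_lim F x0 f -> derivable_pt_lim G x0 g -> F x0 = 0 -> G x0 = 0 ->
  0 <= s -> 0 <= g -> s * g < f ->
  exists2 d, 0 < d &
    forall x, Rabs (x - x0) < d -> s * Rabs (G x) <= Rabs (F x).
Proof.
move=> HF HG F0 G0 s0 g0 sgf.
pose e := (f - s * g) / (1 + s).
have e0 : 0 < e by apply: Rdiv_lt_0_compat; lra.
have H3 : s * (g + e) = f - e by rewrite /e; field; lra.
clearbody e; have [d1 Hd1] := HF e e0; have [d2 Hd2] := HG e e0.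
have d10 := cond_pos d1; have d20 := cond_pos d2.
exists (Rmin d1 d2); first exact: Rmin_pos.
move=> x xd; have m1 := Rmin_l d1 d2; have m2 := Rmin_r d1 d2.
case: (Req_dec x x0) => [->|xx0]; first by rewrite F0 G0 Rabs_R0; lra.
have y0 : x - x0 <> 0 by lra.
have := Hd1 _ y0; have := Hd2 _ y0.
have -> : x0 + (x - x0) = x by ring.
rewrite F0 G0 !Rminus_0_r => /(_ ltac:(lra)) K2 /(_ ltac:(lra)) K1.
have H1 : f - e <= Rabs (F x / (x - x0)).
  have : F x / (x - x0) <= Rabs (F x / (x - x0)) by exact: Rle_abs.
  by move/Rabs_def2: K1; lra.
have H2 : Rabs (G x / (x - x0)) <= g + e.
  have := Rabs_triang (G x / (x - x0) - g) g.
  have -> : G x / (x - x0) - g + g = G x / (x - x0) by ring.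
  by rewrite (Rabs_right g); lra.
have a0 := Rabs_pos_lt _ y0.
have -> : F x = F x / (x - x0) * (x - x0) by field.
have -> : G x = G x / (x - x0) * (x - x0) by field.
rewrite !(Rabs_mult (_ / _)) -Rmult_assoc; apply: Rmult_le_compat_r; first lra.
by apply: Rle_trans (Rmult_le_compat_l _ _ _ s0 H2) _; lra.
Qed.

(* The bump of [cos^(2n)] around [t], translated to [t - s], is dominated by a
   bump around [t - s] which is wider by the factor [t / (t - s)]. *)
Lemma cos_kernel_compare (w x0 s r : R) : 0 < w -> 0 < x0 -> 0 <= s -> 0 <= r ->
  r < x0 / (x0 + s) ->
  exists2 d, 0 < d & forall x (m n : nat), 0 < x -> Rabs (x - x0) < d ->
    INR m <= r ^ 2 * INR n ->
    (cos (w * (ln (x + s) - ln (x0 + s)) / 2) ^ 2) ^ n <=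
    (cos (w * (ln x - ln x0) / 2) ^ 2) ^ m.
Proof.
move=> w0 x00 s0 r0 rx.
pose A x := w * (ln (x + s) - ln (x0 + s)) / 2.
pose B x := w * (ln x - ln x0) / 2.
have Z y : w * (y + - y) * / 2 = 0 by ring.
(* At [x0] both [sin (A x)] and [tan (B x)] vanish, with slopes [w / 2 / (x0 + s)] and [w / 2 / x0];
   the ratio [x0 / (x0 + s)] exceeds [r]. *)
have [d1 d10 Hd1] : exists2 d, 0 < d &
    forall x, Rabs (x - x0) < d -> r * Rabs (tan (B x)) <= Rabs (sin (A x)).
  apply: (@derivable_compare _ _ _ (w / 2 / (x0 + s)) (w / 2 / x0)) => //.
  - apply/is_derive_Reals; rewrite /A; auto_derive; first lra.
    by rewrite Z cos_0; field; lra.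
  - apply/is_derive_Reals; rewrite /B /tan; auto_derive.
      split; first lra; split=> //.
      by rewrite Z cos_0; lra.
    by rewrite Z cos_0 sin_0; field; lra.
  - by rewrite /A Rminus_diag Rmult_0_r /Rdiv Rmult_0_l sin_0.
  - by rewrite /B Rminus_diag Rmult_0_r /Rdiv Rmult_0_l tan_0.
  - by apply: Rlt_le; do 2 apply: Rdiv_lt_0_compat => //; lra.
  have -> : r * (w / 2 / x0) = (w / 2 / x0) * r by ring.
  have -> : w / 2 / (x0 + s) = (w / 2 / x0) * (x0 / (x0 + s)) by field; lra.
  apply: Rmult_lt_compat_l => //.
  by do 2 apply: Rdiv_lt_0_compat => //; lra.
have [d2 d20 Hd2] : exists2 d, 0 < d & forall x, Rabs (x - x0) < d -> 0 < cos (B x).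
  have HB : continuity_pt (fun x => cos (B x)) x0.
    apply: derivable_continuous_pt; apply: (ex_derive_Reals_0 (fun x => cos (B x))).
    by rewrite /B; auto_derive; lra.
  have B0 : cos (B x0) = 1 by rewrite /B Rminus_diag Rmult_0_r /Rdiv Rmult_0_l cos_0.
  have [d [d0 Hd]] := HB 1 Rlt_0_1.
  exists d => // x xd; case: (Req_dec x0 x) => [<-|xx0]; first lra.
  have := Hd x; rewrite /dist /= /R_dist /D_x /no_cond B0 => K.
  by have /Rabs_def2 := K (conj (conj I xx0) xd); lra.
exists (Rmin d1 d2); first exact: Rmin_pos.
move=> x m n x0' xd mn; rewrite -/(A x) -/(B x).
have m1 := Rmin_l d1 d2; have m2 := Rmin_r d1 d2.
have cB : 0 < cos (B x) by apply: Hd2; lra.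
have H : r * Rabs (tan (B x)) <= Rabs (sin (A x)) by apply: Hd1; lra.
have cA : cos (A x) ^ 2 = 1 - sin (A x) ^ 2.
  by have := sin2_cos2 (A x); rewrite /Rsqr /=; lra.
have sA : 0 <= sin (A x) ^ 2 <= 1.
  by split; [exact: pow2_ge_0 | have := pow2_ge_0 (cos (A x)); lra].
(* Here [S] is [sin (A x) ^ 2] and [T] is [cos (B x) ^ 2], so that [(1 - T) / T] is
   [tan (B x) ^ 2]. *)
rewrite cA; apply: pow_compare => //; first exact: pow_lt.
have -> : (1 - cos (B x) ^ 2) / cos (B x) ^ 2 = tan (B x) ^ 2.
  rewrite /tan; have : sin (B x) ^ 2 = 1 - cos (B x) ^ 2.
    by have := sin2_cos2 (B x); rewrite /Rsqr /=; lra.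
  by move=> K; rewrite -K; field; lra.
have H2 : r ^ 2 * tan (B x) ^ 2 <= sin (A x) ^ 2.
  rewrite -Rpow_mult_distr -(pow2_abs (r * _)) -(pow2_abs (sin _)) Rabs_mult.
  rewrite (Rabs_right r); last lra.
  apply: pow_incr; split=> //; apply: Rmult_le_pos => //; exact: Rabs_pos.
have := pow2_ge_0 (tan (B x)); have := pos_INR n.
nra.
Qed.

(** Within half a period of its peak, [cos] decreases in the absolute value of the angle. A distance
    [d] from [t] forces an angle of at least [u]; the two sides of [t] differ on the logarithmic
    scale, hence the inner minimum, and [PI / 4] keeps [cos u] positive. *)
Lemma cos_kernel_tail (w t d : R) : 0 < w -> 0 < d < t ->
  exists2 k, 0 < k < 1 & forall x n, 0 < x -> d <= Rabs (x - t) ->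
    Rabs (w * (ln x - ln t) / 2) <= PI / 2 ->
    (cos (w * (ln x - ln t) / 2) ^ 2) ^ n <= (k ^ n) ^ 2.
Proof.
move=> w0 dt; have pi0 := PI_RGT_0.
pose u := Rmin (PI / 4) (Rmin (w * (ln (t + d) - ln t) / 2) (w * (ln t - ln (t - d)) / 2)).
have l1 : ln t < ln (t + d) by apply: ln_increasing; lra.
have l2 : ln (t - d) < ln t by apply: ln_increasing; lra.
have u0 : 0 < u by do 2 (apply: Rmin_pos; first nra); nra.
have u1 : u <= PI / 4 by exact: Rmin_l.
have u23 := Rmin_r (PI / 4) (Rmin (w * (ln (t + d) - ln t) / 2) (w * (ln t - ln (t - d)) / 2)).
have u2 := Rmin_l (w * (ln (t + d) - ln t) / 2) (w * (ln t - ln (t - d)) / 2).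
have u3 := Rmin_r (w * (ln (t + d) - ln t) / 2) (w * (ln t - ln (t - d)) / 2).
rewrite -/u in u23.
exists (cos u).
  split; first by apply: cos_gt_0; lra.
  by rewrite -cos_0; apply: cos_decreasing_1; lra.
move=> x n x0 dx; set y := w * _ / 2 => yP.
have uy : u <= Rabs y.
  have [xt|xt] : x <= t - d \/ t + d <= x.
    by move: dx; rewrite /Rabs; case: Rcase_abs; lra.
  - have : ln x <= ln (t - d) by apply: ln_le; lra.
    by move=> H; rewrite Rabs_left /y; nra.
  - have : ln (t + d) <= ln x by apply: ln_le; lra.
    by move=> H; rewrite Rabs_right /y; nra.
have -> : cos y = cos (Rabs y).
  by rewrite /Rabs; case: Rcase_abs => // _; rewrite cos_neg.
have -> : (cos u ^ n) ^ 2 = (cos u ^ 2) ^ n by rewrite -!pow_mult Nat.mul_comm.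
apply: pow_incr; split; first exact: pow2_ge_0.
apply: pow_incr; split.
  by apply: cos_ge_0; have := Rabs_pos y; lra.
by apply: cos_decr_1; have := Rabs_pos y; lra.
Qed.

Lemma cos_sqr_add_INR_PI (x : R) (k : nat) : cos (x + INR k * PI) ^ 2 = cos x ^ 2.
Proof.
elim: k => [|k IH]; first by rewrite Rmult_0_l Rplus_0_r.
rewrite S_INR -IH.
have -> : x + (INR k + 1) * PI = x + INR k * PI + PI by ring.
by rewrite neg_cos; ring.
Qed.

(** * Pascal's triangle modulo a prime *)

Section Lucas.
Import GRing.Theory.
Local Open Scope ring_scope.

Lemma coef_add1X_exp (R : comNzRingType) (n i : nat) :
  ((1 + 'X) ^+ n : {poly R})`_i = 'C(n, i)%:R.
Proof.
elim: n i => [|n IH] i; first by rewrite expr0 coef1; case: i => [|i] //=; rewrite bin0n.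
rewrite exprSr mulrDr mulr1 coefD coefMX !IH; case: i => [|i] /=.
  by rewrite addr0 !bin0.
by rewrite binS natrD addrC.
Qed.

(** With [P = p ^ k], the polynomial [(1 + X)^(P m + m')] over ['F_p] equals
    [(1 + X^P)^m (1 + X)^m']. In its coefficient of [X^(P n + n')], the second factor contributes an
    exponent [j <= m' < P] congruent to [n'] modulo [P], so only [j = n'] survives. *)
Lemma lucas (p k m n m' n' : nat) : prime p ->
  (m' < p ^ k)%N -> (n' < p ^ k)%N ->
  (p %| 'C(p ^ k * m + m', p ^ k * n + n'))%N =
  (p %| 'C(m, n))%N || (p %| 'C(m', n'))%N.
Proof.
move=> pr_p Hm Hn; set P := (p ^ k)%N in Hm Hn *.
have P0 : (0 < P)%N by rewrite expn_gt0 prime_gt0.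
pose K := 'F_p.
have chK : p \in [pchar {poly K}] by rewrite pchar_poly pchar_Fp.
have dvdE i : (p %| i)%N = (i%:R == 0 :> K) by rewrite (dvdn_pcharf (pchar_Fp pr_p)).
have E : (1 + 'X) ^+ (P * m + m') = ((1 + 'X) ^+ m \Po 'X^P) * (1 + 'X) ^+ m' :> {poly K}.
  rewrite exprD exprM; congr (GRing.mul _ _).
  have -> : (1 + 'X) ^+ P = 1 + 'X^P :> {poly K}.
    rewrite exprDn_pchar ?expr1n //.
    by rewrite (eq_pnat _ (pcharf_eq chK)) pnatX pnat_id.
  by rewrite rmorphXn /= comp_polyD comp_polyX -(polyC1 K) comp_polyC.
rewrite !dvdE -mulf_eq0 -!natrM -coef_add1X_exp E coefMr.
rewrite (bigD1 (inord n')) //= inordK ?ltnS ?leq_addl // addnK.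
rewrite coef_comp_poly_Xn // dvdn_mulr // mulKn // !coef_add1X_exp.
rewrite big1 ?addr0 -?natrM // => j Hj.
rewrite coef_comp_poly_Xn // !coef_add1X_exp.
have [jm|mj] := leqP j m'; last by rewrite (@bin_small m' j) // mulr0n mulr0.
case: ifP => [/dvdnP [i Hi]|_]; last by rewrite mul0r.
case/negP: Hj; apply/eqP/val_inj; rewrite /= inordK ?ltnS ?leq_addl //.
have jle : (j <= P * n + n')%N by rewrite -ltnS.
have : (n * P + n' = i * P + j)%N by rewrite -Hi [(n * P)%N]mulnC subnK.
move=> /(congr1 (modn^~ P)); rewrite !modnMDl !modn_small //.
exact: leq_ltn_trans Hm.
Qed.
End Lucas.

Lemma PasE (p m n : nat) : Pas p m n = ~~ (p %| 'C(m, n))%N.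
Proof. by rewrite /Pas; case: leqP => //= mn; rewrite bin_small // dvdn0. Qed.

Lemma Pas_leq (p m n : nat) : Pas p m n -> (n <= m)%N.
Proof. by case/andP. Qed.

(** The binomial coefficient divides [m!], a product of numbers below [p]. *)
Lemma Pas_small (p m n : nat) : prime p -> (m < p)%N -> Pas p m n = (n <= m)%N.
Proof.
move=> pr_p mp; rewrite /Pas; case: leqP => //= nm.
apply/negP => H; have := bin_fact nm => E.
have : (p %| m`!)%N by rewrite -E dvdn_mulr.
elim: m mp {nm H E} => [|m IH] mp; first by rewrite fact0 Euclid_dvd1.
rewrite factS Euclid_dvdM // => /orP [/dvdn_leq|]; first by lia.
by apply: IH; exact: ltnW.
Qed.

Lemma Pas_digits (p k m n m' n' : nat) : prime p ->
  (m' < p ^ k)%N -> (n' < p ^ k)%N ->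
  Pas p (p ^ k * m + m') (p ^ k * n + n') = Pas p m n && Pas p m' n'.
Proof. by move=> *; rewrite !PasE lucas // negb_or. Qed.

Lemma Pas0 (p m : nat) : prime p -> Pas p m 0.
Proof. by move=> pr_p; rewrite PasE bin0 Euclid_dvd1. Qed.

Definition indic (b : bool) : R := if b then 1 else 0.

Lemma indic_andb (a b : bool) : indic (a && b) = indic a * indic b.
Proof. by case: a; case: b; rewrite /indic /=; ring. Qed.

Lemma rsum_indic_leq (a p : nat) : (a < p)%N ->
  rsum (fun b => indic (b <= a)%N) p = INR a.+1.
Proof.
move=> ap; rewrite (@rsum_widen _ a.+1) //.
  rewrite (@rsum_ext _ (fun=> 1)) ?rsum_const ?Rmult_1_r // => i.
  by rewrite ltnS => ->.
by move=> i Hi; rewrite leqNgt; case: ltnP Hi => //; lia.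
Qed.

(** By Lucas the lowest base [p] digits of [m] and [n] split off as an independent pair
    [b <= a < p], for which there are [p (p + 1) / 2] choices. *)
Lemma Pas_count (p k : nat) : prime p ->
  rsum (fun m => rsum (fun n => indic (Pas p m n)) (p ^ k)%N) (p ^ k)%N =
  (INR p * (INR p + 1) / 2) ^ k.
Proof.
move=> pr_p; have p0 := prime_gt0 pr_p.
elim: k => [|k IH]; first by rewrite expn0 /= /Pas bin0 Euclid_dvd1 //= /indic; ring.
rewrite expnS rsum_mul -tech_pow_Rmult -IH.
transitivity (rsum (fun m => rsum (fun a => rsum (fun n => rsum (fun b =>
    indic (Pas p a b) * indic (Pas p m n)) p) (p ^ k)%N) p) (p ^ k)%N).
  apply: rsum_ext => m _; apply: rsum_ext => a ap; rewrite rsum_mul.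
  apply: rsum_ext => n _; apply: rsum_ext => b bp.
  by rewrite -indic_andb -{1 2}(expn1 p) Pas_digits ?expn1 // andbC.
transitivity (rsum (fun m => rsum (fun n => indic (Pas p m n) *
    rsum (fun a => rsum (fun b => indic (Pas p a b)) p) p) (p ^ k)%N) (p ^ k)%N).
  apply: rsum_ext => m _; rewrite rsum_exchange; apply: rsum_ext => n _.
  rewrite -rsum_scal; apply: rsum_ext => a _; rewrite -rsum_scal.
  by apply: rsum_ext => b _; ring.
have -> : rsum (fun a => rsum (fun b => indic (Pas p a b)) p) p =
    INR p * (INR p + 1) / 2.
  transitivity (rsum (fun a => INR a.+1) p).
    apply: rsum_ext => a ap; rewrite -(rsum_indic_leq ap).
    by apply: rsum_ext => b bp; rewrite Pas_small.
  elim: {pr_p p0 IH} p => [|p IHp]; first by rewrite /=; field.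
  by rewrite -[rsum _ _]/(rsum _ p + INR p.+1) IHp !S_INR; field.
rewrite -rsum_scal; apply: rsum_ext => m _; rewrite -rsum_scal.
by apply: rsum_ext => n _; ring.
Qed.

(** Compare the quotients by [P = p ^ k]. If [n < P], that of [n] is 0, and lowering that of [m]
    keeps the pair in [Pas p]. If [n >= P], both quotients turn out to be 1, and both drop to 0. *)
Lemma Pas_shift (p c k m n : nat) : prime p -> (0 < c)%N -> Pas p m n ->
  (c.+1 * p ^ k <= m + c * n < c.+2 * p ^ k)%N ->
  (p ^ k <= m)%N /\
  (Pas p (m - p ^ k) n \/ (p ^ k <= n)%N /\ Pas p (m - p ^ k) (n - p ^ k)).
Proof.
move=> pr_p c0 Hp /andP [H1 H2].
have P0 : (0 < p ^ k)%N by rewrite expn_gt0 prime_gt0.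
set P := (p ^ k)%N in P0 H1 H2 *.
have nm := Pas_leq Hp.
have Pm : (P <= m)%N by rewrite leqNgt; apply/negP => mP; nia.
split=> //.
have Dm := divn_eq m P; have Dn := divn_eq n P.
have m'P : (m %% P < P)%N by rewrite ltn_mod.
have n'P : (n %% P < P)%N by rewrite ltn_mod.
have m1 : (0 < m %/ P)%N by rewrite divn_gt0.
move: Hp; rewrite {1}Dm {1}Dn ![(_ * P)%N]mulnC Pas_digits // => /andP [Hp1 Hp2].
have [nP|Pn] := ltnP n P.
  left.
  have -> : (m - P = P * (m %/ P).-1 + m %% P)%N by nia.
  have -> : n = (P * 0 + n %% P)%N by rewrite muln0 modn_small.
  by rewrite Pas_digits // Pas0.
right; split=> //.
have n1 : (0 < n %/ P)%N by rewrite divn_gt0.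
have nm1 := Pas_leq Hp1.
(* A quotient of at least 2, together with [n >= P], would give [m + c * n >= c.+2 * P]. *)
have m11 : (m %/ P = 1)%N by nia.
have n11 : (n %/ P = 1)%N by lia.
have -> : (m - P = P * 0 + m %% P)%N by lia.
have -> : (n - P = P * 0 + n %% P)%N by lia.
by rewrite Pas_digits // Pas0.
Qed.

(** * The Dirichlet series *)

Lemma INR_ge1 (n : nat) : (0 < n)%N -> 1 <= INR n.
Proof. by move=> n0; rewrite -[1]/(INR 1); apply: le_INR; lia. Qed.

Lemma ln_INR_ge0 (n : nat) : (0 < n)%N -> 0 <= ln (INR n).
Proof. by move=> /INR_ge1 n1; rewrite -ln_1; apply: ln_le; lra. Qed.

Lemma INR_expn (p k : nat) : INR (p ^ k)%N = INR p ^ k.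
Proof.
elim: k => [|k IH]; first by rewrite expn0.
by rewrite expnS -multE mult_INR IH.
Qed.

Lemma exp_le (x y : R) : x <= y -> exp x <= exp y.
Proof.
by case=> [xy|->]; [apply: Rlt_le; exact: exp_increasing | exact: Rle_refl].
Qed.

Lemma exp_mul_INR (x : R) (n : nat) : exp (x * INR n) = exp x ^ n.
Proof.
elim: n => [|n IH]; first by rewrite Rmult_0_r exp_0.
by rewrite S_INR Rmult_plus_distr_l Rmult_1_r exp_plus IH /=; ring.
Qed.

Lemma exp_partial_sum_le (x : R) (n : nat) :
  0 <= x -> rsum (fun k => x ^ k / INR (Factorial.fact k)) n <= exp x.
Proof.
move=> x0.
have H0 k : 0 <= x ^ k / INR (Factorial.fact k).
  apply: Rmult_le_pos; first exact: pow_le.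
  by apply: Rlt_le; apply: Rinv_0_lt_compat; exact: INR_fact_lt_0.
have H : is_series (fun k => x ^ k / INR (Factorial.fact k)) (exp x).
  apply: is_series_ext (is_exp_Reals x) => k.
  by rewrite pow_n_pow.
rewrite -(is_series_unique _ _ H); apply: rsum_le_Series => //.
by exists (exp x).
Qed.

Section Zeta.

Variables (p c : nat).
Hypotheses (pr_p : prime p) (c_gt0 : (0 < c)%N).

Let q := INR p * (INR p + 1) / 2.

Let p_ge2 : 2 <= INR p.
Proof. by rewrite -[2]/(INR 2); apply: le_INR; have := prime_gt1 pr_p; lia. Qed.

Lemma ln_p_gt0 : 0 < ln (INR p).
Proof. by rewrite -ln_1; apply: ln_increasing; lra. Qed.

Lemma exp_theta : exp (theta p * ln (INR p)) = q.
Proof.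
have H := ln_p_gt0.
rewrite /theta /Rdiv Rmult_assoc Rinv_l ?Rmult_1_r; last lra.
by rewrite exp_ln //; nra.
Qed.

Lemma theta_gt1 : 1 < theta p.
Proof.
have H := ln_p_gt0.
apply: (Rmult_lt_reg_r (ln (INR p))) => //; rewrite Rmult_1_l.
apply: exp_lt_inv; rewrite exp_theta exp_ln /q; nra.
Qed.

Let q_gt1 : 1 < q.
Proof. by rewrite /q; nra. Qed.

Definition zval (m n : nat) : nat := (m + c * n)%N.

(* [f] twists the Dirichlet series [sum v^(-s)]; only the weight at [v = 0],
   where [ln 0 = 0] is a junk value, has to be excluded. *)
Definition weight (s : R) (m n : nat) : R :=
  if Pas p m n && (0 < zval m n)%N then exp (- s * ln (INR (zval m n))) else 0.

Definition zrow (s : R) (f : nat -> R) (m : nat) : R :=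
  rsum (fun n => weight s m n * f (zval m n)) m.+1.

Definition zsum (s : R) (f : nat -> R) : R := Series (zrow s f).

Lemma weight_ge0 (s : R) (m n : nat) : 0 <= weight s m n.
Proof.
by rewrite /weight; case: ifP => _; [exact: Rlt_le (exp_pos _) | lra].
Qed.

Lemma weight_Pas0 (s : R) (m n : nat) : (m < n)%N -> weight s m n = 0.
Proof. by move=> mn; rewrite /weight /Pas leqNgt mn. Qed.

Lemma zrow_widen (s : R) (f : nat -> R) (m N : nat) : (m < N)%N ->
  zrow s f m = rsum (fun n => weight s m n * f (zval m n)) N.
Proof.
move=> mN; rewrite (@rsum_widen _ m.+1 N) // => n /andP [mn _].
by rewrite weight_Pas0 // Rmult_0_l.
Qed.

Lemma zrow_le (s : R) (f g : nat -> R) (m : nat) :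
  (forall v, f v <= g v) -> zrow s f m <= zrow s g m.
Proof.
move=> fg; apply: rsum_le => n _; apply: Rmult_le_compat_l => //.
exact: weight_ge0.
Qed.

Lemma zrow_ge0 (s : R) (f : nat -> R) (m : nat) :
  (forall v, 0 <= f v) -> 0 <= zrow s f m.
Proof.
move=> f0; apply: rsum_ge0 => n _; apply: Rmult_le_pos => //.
exact: weight_ge0.
Qed.

Lemma zrow_plus (s : R) (f g : nat -> R) (m : nat) :
  zrow s (fun v => f v + g v) m = zrow s f m + zrow s g m.
Proof. by rewrite -rsum_plus; apply: rsum_ext => n _; ring. Qed.

Lemma zrow_scal (s a : R) (f : nat -> R) (m : nat) :
  zrow s (fun v => a * f v) m = a * zrow s f m.
Proof. by rewrite -rsum_scal; apply: rsum_ext => n _; ring. Qed.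

Lemma zrow_abs_le (s B : R) (f : nat -> R) (m : nat) :
  (forall v, Rabs (f v) <= B) -> Rabs (zrow s f m) <= B * zrow s (fun=> 1) m.
Proof.
move=> fB; apply: Rle_trans (rsum_abs _ _) _.
rewrite -zrow_scal; apply: rsum_le => n _.
rewrite Rabs_mult (Rabs_right (weight _ _ _)); last exact: Rle_ge (weight_ge0 _ _ _).
rewrite Rmult_1_r; apply: Rmult_le_compat_l => //; exact: weight_ge0.
Qed.

(** * Convergence exactly to the right of [theta p] *)

Let count (k : nat) : R :=
  rsum (fun m => rsum (fun n => indic (Pas p m n)) m.+1) (p ^ k)%N.

Let countE (k : nat) : count k = q ^ k.
Proof.
rewrite -(Pas_count k pr_p); apply: rsum_ext => m Hm.
by rewrite [RHS](@rsum_widen _ m.+1) // => n /andP [mn _]; rewrite /Pas leqNgt mn.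
Qed.

Let expn_p_gt0 (k : nat) : (0 < p ^ k)%N.
Proof. by rewrite expn_gt0 prime_gt0. Qed.

Let expn_p_mono (k : nat) : (p ^ k <= p ^ k.+1)%N.
Proof. by rewrite leq_exp2l // prime_gt1. Qed.

Let ln_expn (k : nat) : ln (INR (p ^ k)%N) = INR k * ln (INR p).
Proof. by rewrite INR_expn ln_pow //; lra. Qed.

(** The rows [p^k <= m < p^(k+1)] hold at most [q^(k+1)] points, each of weight at most [p^(-k s)].
    As [q = p^(theta p)], the block is at most [q * x ^ k], and these bounds form a geometric
    series. *)
Lemma zrow_bounded (s : R) (k : nat) : theta p < s ->
  rsum (zrow s (fun=> 1)) (p ^ k)%N <= q / (1 - exp ((theta p - s) * ln (INR p))).
Proof.
move=> ths; have th1 := theta_gt1; have lp := ln_p_gt0.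
set x := exp _.
have x0 : 0 < x by exact: exp_pos.
have x1 : x < 1 by rewrite -exp_0; apply: exp_increasing; nra.
suff H : rsum (zrow s (fun=> 1)) (p ^ k)%N <= q * ((1 - x ^ k) / (1 - x)).
  apply: Rle_trans H _; have xk := pow_lt x k x0.
  rewrite /Rdiv -Rmult_assoc; apply: Rmult_le_compat_r.
    by apply: Rlt_le; apply: Rinv_0_lt_compat; lra.
  nra.
elim: k => [|k IH].
  by rewrite /= /zrow /= /weight /zval muln0 addn0 /= andbF; apply: Req_le; field; lra.
have -> : (p ^ k.+1 = p ^ k + (p ^ k.+1 - p ^ k))%N by rewrite subnKC.
rewrite rsum_cat.
have Hb : rsum (fun i => zrow s (fun=> 1) (p ^ k + i)) (p ^ k.+1 - p ^ k) <= q * x ^ k.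
  apply: (@Rle_trans _ (exp (- s * (INR k * ln (INR p))) * count k.+1)).
    rewrite /count.
    have -> : (p ^ k.+1 = p ^ k + (p ^ k.+1 - p ^ k))%N by rewrite subnKC.
    rewrite addKn rsum_cat Rmult_plus_distr_l -!rsum_scal.
    set A := rsum _ _; set B := rsum _ _; set D := rsum _ _.
    suff : A <= D.
      suff : 0 <= B by lra.
      apply: rsum_ge0 => i _; apply: Rmult_le_pos; first exact: Rlt_le (exp_pos _).
      by apply: rsum_ge0 => j _; rewrite /indic; case: ifP => _; lra.
    apply: rsum_le => i _; rewrite -rsum_scal; apply: rsum_le => n _.
    rewrite Rmult_1_r /weight /indic; case: ifP => [/andP [-> v0]|_]; last first.
      have := exp_pos (- s * (INR k * ln (INR p))); case: ifP => _; lra.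
    rewrite Rmult_1_r; apply: exp_le.
    rewrite -ln_expn.
    have : ln (INR (p ^ k)) <= ln (INR (zval (p ^ k + i) n)).
      apply: ln_le; last by apply: le_INR; rewrite /zval; lia.
      by have := INR_ge1 (expn_p_gt0 k); lra.
    nra.
  apply: Req_le; rewrite countE /x -exp_mul_INR.
  have -> : (theta p - s) * ln (INR p) * INR k =
    theta p * ln (INR p) * INR k + - s * (INR k * ln (INR p)) by ring.
  by rewrite exp_plus exp_mul_INR exp_theta /=; ring.
have -> : q * ((1 - x ^ k.+1) / (1 - x)) = q * ((1 - x ^ k) / (1 - x)) + q * x ^ k.
  by rewrite /=; field; lra.
lra.
Qed.

Lemma ex_zrow1 (s : R) : theta p < s -> ex_series (zrow s (fun=> 1)).
Proof.
move=> ths; apply: ex_series_bounded => [m|n].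
  by apply: zrow_ge0 => _; lra.
exists (p ^ n)%N; first exact: ltnW (ltn_expl n (prime_gt1 pr_p)).
exact: zrow_bounded.
Qed.

Lemma ex_zrow (s B : R) (f : nat -> R) : theta p < s ->
  (forall v, Rabs (f v) <= B) -> ex_series (zrow s f).
Proof.
move=> ths fB.
apply: (@ex_series_dominated _ (fun m => B * zrow s (fun=> 1) m)).
  by move=> m; exact: zrow_abs_le.
by apply: (@ex_series_scal R_AbsRing R_NormedModule); exact: ex_zrow1.
Qed.

Let h : R := INR c.+1.

Let h_ge1 : 1 <= h.
Proof. exact: INR_ge1. Qed.

Let zval_bound (m n P : nat) : (n <= m)%N -> (m < P)%N ->
  (0 < zval m n)%N -> ln (INR (zval m n)) <= ln (h * INR P).
Proof.
move=> nm mP v0; apply: ln_le; first by have := INR_ge1 v0; lra.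
rewrite /h -mult_INR; apply: le_INR; rewrite /zval.
by apply/leP; rewrite multE mulSn leq_add ?leq_mul //; lia.
Qed.

(** At [theta p] every block [p^k <= m < p^(k+1)] contributes at least the same constant: it holds
    [q^(k+1) - q^k] points with [v <= h p^(k+1)]. *)
Let zrow_theta_unbounded (k : nat) :
  INR k * ((1 - / q) * exp (- theta p * ln h)) <=
  rsum (zrow (theta p) (fun=> 1)) (p ^ k)%N.
Proof.
have th1 := theta_gt1; have lp := ln_p_gt0.
set b := (1 - / q) * _.
elim: k => [|k IH].
  by rewrite /= Rmult_0_l Rplus_0_l; apply: zrow_ge0 => _; lra.
have -> : (p ^ k.+1 = p ^ k + (p ^ k.+1 - p ^ k))%N by rewrite subnKC.
rewrite rsum_cat S_INR Rmult_plus_distr_r Rmult_1_l.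
apply: Rplus_le_compat => //.
pose e := exp (- theta p * ln (h * INR (p ^ k.+1))).
have eE : e = exp (- theta p * ln h) * / q ^ k.+1.
  rewrite /e ln_mult; [|lra|by have := INR_ge1 (expn_p_gt0 k.+1); lra].
  rewrite ln_expn -exp_theta -exp_mul_INR -exp_Ropp -exp_plus.
  by congr exp; ring.
have e0 : 0 < e by exact: exp_pos.
apply: (@Rle_trans _ (e * (count k.+1 - count k))).
  apply: Req_le; rewrite eE !countE /b /=; field.
  by split; [apply: pow_nonzero|]; lra.
rewrite /count; have {1}-> : (p ^ k.+1 = p ^ k + (p ^ k.+1 - p ^ k))%N by rewrite subnKC.
rewrite rsum_cat.
set A := rsum _ _; set B := rsum _ _; set D := rsum _ _.
have -> : A + B - A = B by ring.
rewrite -rsum_scal; apply: rsum_le => i Hi; rewrite -rsum_scal.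
apply: rsum_le => n Hn.
rewrite Rmult_1_r /weight /indic; have [_|] := boolP (Pas p _ n); last by rewrite /=; lra.
have v0 : (0 < zval (p ^ k + i) n)%N by have := expn_p_gt0 k; rewrite /zval; lia.
rewrite v0 /= Rmult_1_r; apply: exp_le.
have : ln (INR (zval (p ^ k + i) n)) <= ln (h * INR (p ^ k.+1)).
  by apply: zval_bound => //; move: Hi; lia.
by move=> H; rewrite !Ropp_mult_distr_l_reverse; apply: Ropp_le_contravar; nra.
Qed.

Let b_gt0 : 0 < (1 - / q) * exp (- theta p * ln h).
Proof.
apply: Rmult_lt_0_compat; last exact: exp_pos.
by have := Rinv_1_lt_contravar 1 q (Rle_refl _) q_gt1; rewrite Rinv_1; lra.
Qed.

Let unbounded (M : R) : exists k, M <= rsum (zrow (theta p) (fun=> 1)) (p ^ k)%N.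
Proof.
have [k Hk] := INR_unbounded (M / ((1 - / q) * exp (- theta p * ln h))).
exists k; apply: Rle_trans (zrow_theta_unbounded k); apply: Rlt_le.
by move: Hk => /Rlt_gt/(Rmult_gt_compat_r _ _ _ b_gt0); rewrite /Rdiv Rmult_assoc Rinv_l; lra.
Qed.

Lemma ex_zrow1_gt (s : R) : ex_series (zrow s (fun=> 1)) -> theta p < s.
Proof.
move=> Es; apply: Rnot_le_lt => sth.
have Eth : ex_series (zrow (theta p) (fun=> 1)).
  apply: ex_series_dominated Es => m.
  rewrite Rabs_right; last by apply: Rle_ge; apply: zrow_ge0 => _; lra.
  apply: rsum_le => n _; rewrite !Rmult_1_r /weight.
  case: ifP => [/andP [_ v0]|_]; last lra.
  by apply: exp_le; have := ln_INR_ge0 v0; nra.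
have [k Hk] := unbounded (Series (zrow (theta p) (fun=> 1)) + 1).
have := @rsum_le_Series _ (p ^ k)%N (fun m => @zrow_ge0 (theta p) _ m (fun=> Rle_0_1)) Eth.
lra.
Qed.

(** Take a finite partial sum at [theta p] that is at least [2 M]. For small [e] the factor [v^(-e)]
    is at least [1 / 2] on its finitely many terms, since [e * ln v <= ln 2] there. *)
Lemma zsum1_unbounded (M : R) :
  exists2 d, 0 < d & forall e, 0 < e < d -> M <= zsum (theta p + e) (fun=> 1).
Proof.
have [k Hk] := unbounded (2 * Rmax M 0).
have P1 := INR_ge1 (expn_p_gt0 k).
pose V := ln (h * INR (p ^ k)).
have V0 : 0 <= V by rewrite -ln_1; apply: ln_le; nra.
have ln2 : 0 < ln 2 by rewrite -ln_1; apply: ln_increasing; lra.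
exists (ln 2 / (V + 1)) => [|e [e0 ed]].
  by apply: Rdiv_lt_0_compat; lra.
have eV : e * V <= ln 2.
  have : e * (V + 1) < ln 2; last nra.
  by move: ed => /(Rmult_lt_compat_r (V + 1)); rewrite /Rdiv Rmult_assoc Rinv_l; lra.
apply: (@Rle_trans _ (rsum (zrow (theta p + e) (fun=> 1)) (p ^ k)%N)); last first.
  apply: rsum_le_Series; first by move=> m; apply: zrow_ge0 => _; lra.
  by apply: ex_zrow1; lra.
apply: (@Rle_trans _ (/ 2 * rsum (zrow (theta p) (fun=> 1)) (p ^ k)%N)).
  by have := Rmax_l M 0; lra.
rewrite -rsum_scal; apply: rsum_le => m mP; rewrite -rsum_scal.
apply: rsum_le => n nm; rewrite !Rmult_1_r /weight.
case: ifP => [/andP [_ v0]|_]; last lra.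
have -> : / 2 = exp (- ln 2) by rewrite exp_Ropp exp_ln //; lra.
rewrite -exp_plus; apply: exp_le.
have := @zval_bound m n (p ^ k) nm mP v0; have := ln_INR_ge0 v0; rewrite -/V.
nra.
Qed.

(** Expand [v^(-t) = exp (- t ln v)] in powers of [t] and exchange the sums. With [r] half the
    distance from [s] to [theta p], the row of absolute values is dominated by [B] times the row at
    [s - r], still to the right of [theta p]. *)
Lemma zsum_line_analytic (s B : R) (f : nat -> R) : theta p < s ->
  (forall v, Rabs (f v) <= B) -> line_analytic_at (fun t => zsum t f) s.
Proof.
move=> ths fB.
pose l v := ln (INR v).
pose fc k := / INR (Factorial.fact k).
have fc0 k : 0 < fc k by apply: Rinv_0_lt_compat; exact: INR_fact_lt_0.
pose a m k := rsum (fun n => weight s m n * f (zval m n) * ((- l (zval m n)) ^ k * fc k)) m.+1.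
pose r := (s - theta p) / 2.
have r0 : 0 < r by rewrite /r; lra.
have B0 : 0 <= B by apply: Rle_trans (fB 0%N); exact: Rabs_pos.
exists (fun k => Series (a^~ k)), r; split=> // t tr.
have row m : is_series (fun k => t ^ k * a m k) (zrow (s + t) f m).
  have term n : is_series (fun k => weight s m n * f (zval m n) * ((t * - l (zval m n)) ^ k * fc k))
      (weight (s + t) m n * f (zval m n)).
    have E := is_exp_Reals (t * - l (zval m n)).
    have := @is_series_scal R_AbsRing R_NormedModule (weight s m n * f (zval m n)) _ _ E.
    have -> : scal (weight s m n * f (zval m n)) (exp (t * - l (zval m n))) =
        weight (s + t) m n * f (zval m n).
      rewrite /weight; case: ifP => _; last by rewrite /scal /= /mult /=; ring.
      have -> : - (s + t) * ln (INR (zval m n)) =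
        - s * ln (INR (zval m n)) + t * - l (zval m n) by rewrite /l; ring.
      by rewrite exp_plus /scal /= /mult /=; ring.
    apply: is_series_ext => k; rewrite pow_n_pow.
    by rewrite /scal /= /mult /=.
  have [E1 E2] := @Series_rsum (fun n k => weight s m n * f (zval m n) *
    ((t * - l (zval m n)) ^ k * fc k)) m.+1 (fun n => ex_intro _ _ (term n)).
  have -> : zrow (s + t) f m = Series (fun k => rsum (fun n => weight s m n *
      f (zval m n) * ((t * - l (zval m n)) ^ k * fc k)) m.+1).
    by rewrite E2; apply: rsum_ext => n _; rewrite (is_series_unique _ _ (term n)).
  apply: is_series_ext (Series_correct _ E1) => k.
  rewrite /a -rsum_scal; apply: rsum_ext => n _.
  by rewrite Rpow_mult_distr; ring.
have bound m N : rsum (fun k => Rabs (t ^ k * a m k)) N <= B * zrow (s - r) (fun=> 1) m.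
  apply: (@Rle_trans _ (rsum (fun k => rsum (fun n => weight s m n * B *
      ((r * l (zval m n)) ^ k * fc k)) m.+1) N)).
    apply: rsum_le => k _; rewrite /a -rsum_scal; apply: Rle_trans (rsum_abs _ _) _.
    apply: rsum_le => n _.
    rewrite /weight; case: ifP => [/andP [_ v0]|_]; last first.
      by rewrite !Rmult_0_l Rmult_0_r Rabs_R0; lra.
    have l0 : 0 <= l (zval m n) by exact: ln_INR_ge0.
    rewrite !Rabs_mult -!RPow_abs Rabs_Ropp (Rabs_right (exp _)); last exact: Rle_ge (Rlt_le _ _ (exp_pos _)).
    rewrite (Rabs_right (l _)); last lra.
    rewrite (Rabs_right (fc k)); last by have := fc0 k; lra.
    have -> : Rabs t ^ k * (exp (- s * ln (INR (zval m n))) * Rabs (f (zval m n)) *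
        (l (zval m n) ^ k * fc k)) = exp (- s * ln (INR (zval m n))) * Rabs (f (zval m n)) *
        ((Rabs t * l (zval m n)) ^ k * fc k) by rewrite Rpow_mult_distr; ring.
    have t0 := Rabs_pos t.
    apply: Rmult_le_compat.
    - by apply: Rmult_le_pos; [exact: Rlt_le (exp_pos _) | exact: Rabs_pos].
    - by apply: Rmult_le_pos; [apply: pow_le; nra | exact: Rlt_le].
    - by apply: Rmult_le_compat_l; [exact: Rlt_le (exp_pos _) | ].
    - apply: Rmult_le_compat_r; first exact: Rlt_le.
      by apply: pow_incr; nra.
  rewrite rsum_exchange -zrow_scal; apply: rsum_le => n _.
  rewrite (@rsum_scal (weight s m n * B)) /weight.
  case: ifP => [/andP [_ v0]|_]; last lra.
  have := @exp_partial_sum_le (r * l (zval m n)) N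
    (Rmult_le_pos _ _ (Rlt_le _ _ r0) (ln_INR_ge0 v0)).
  have -> : - (s - r) * ln (INR (zval m n)) =
    - s * ln (INR (zval m n)) + r * l (zval m n) by rewrite /l; ring.
  rewrite exp_plus => H.
  have := exp_pos (- s * ln (INR (zval m n))) => e0.
  have -> : exp (- s * ln (INR (zval m n))) * exp (r * l (zval m n)) * (B * 1) =
    exp (- s * ln (INR (zval m n))) * B * exp (r * l (zval m n)) by ring.
  by apply: Rmult_le_compat_l => //; nra.
have EB : ex_series (fun m => B * zrow (s - r) (fun=> 1) m).
  apply: (@ex_series_scal R_AbsRing R_NormedModule); apply: ex_zrow1.
  by rewrite /r; lra.
have := @Series_fubini (fun m k => t ^ k * a m k) _ (fun m => ex_intro _ _ (row m)) bound EB.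
rewrite (Series_ext _ _ (fun m => is_series_unique _ _ (row m))).
apply: is_series_ext => k.
by rewrite Series_scal_l pow_n_pow.
Qed.

(** * Mean values along the Dirichlet series *)

Definition zfreq : R := 2 * PI / ln (INR p).

Lemma zfreq_gt0 : 0 < zfreq.
Proof. by have := PI_RGT_0; have := ln_p_gt0 => *; apply: Rdiv_lt_0_compat; lra. Qed.

Lemma zfreq_ln_p : zfreq * ln (INR p) = 2 * PI.
Proof. by have := ln_p_gt0 => *; rewrite /zfreq; field; lra. Qed.

Lemma zsum_plus (s A B : R) (f g : nat -> R) : theta p < s ->
  (forall v, Rabs (f v) <= A) -> (forall v, Rabs (g v) <= B) ->
  zsum s (fun v => f v + g v) = zsum s f + zsum s g.
Proof.
move=> ths fA gB; rewrite -Series_plus; [|exact: ex_zrow fA|exact: ex_zrow gB].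
by apply: Series_ext => m; exact: zrow_plus.
Qed.

Lemma zsum_scal (s a : R) (f : nat -> R) :
  zsum s (fun v => a * f v) = a * zsum s f.
Proof. by rewrite -Series_scal_l; apply: Series_ext => m; exact: zrow_scal. Qed.

(** Since the total mass is unbounded as [e -> 0+], a bounded error makes [mu] the limit of the
    quotient of the two sums. Bounded errors are stable under linear combinations and are what the
    absence of a pole provides. *)
Definition has_mean (f : nat -> R) (mu : R) : Prop :=
  (exists B, forall v, Rabs (f v) <= B) /\
  exists C d, 0 < d /\ forall e, 0 < e < d ->
    Rabs (zsum (theta p + e) f - mu * zsum (theta p + e) (fun=> 1)) <= C.

Lemma zsum_ext (s : R) (f g : nat -> R) : f =1 g -> zsum s f = zsum s g.
Proof.
by move=> fg; apply: Series_ext => m; apply: rsum_ext => n _; rewrite fg.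
Qed.

Lemma has_mean_ext (f g : nat -> R) (mu : R) :
  f =1 g -> has_mean f mu -> has_mean g mu.
Proof.
move=> fg [[B fB] [C [d [d0 Hd]]]]; split; first by exists B => v; rewrite -fg.
by exists C, d; split=> // e /Hd; rewrite (zsum_ext _ fg).
Qed.

Lemma has_mean_scal (a : R) (f : nat -> R) (mu : R) :
  has_mean f mu -> has_mean (fun v => a * f v) (a * mu).
Proof.
move=> [[B fB] [C [d [d0 Hd]]]]; split.
  exists (Rabs a * B) => v; rewrite Rabs_mult.
  by apply: Rmult_le_compat_l => //; exact: Rabs_pos.
exists (Rabs a * C), d; split=> // e He.
rewrite zsum_scal Rmult_assoc -Rmult_minus_distr_l Rabs_mult.
by apply: Rmult_le_compat_l; [exact: Rabs_pos | exact: Hd].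
Qed.

Lemma has_mean_plus (f g : nat -> R) (mu nu : R) :
  has_mean f mu -> has_mean g nu -> has_mean (fun v => f v + g v) (mu + nu).
Proof.
move=> [[A fA] [C [d [d0 Hd]]]] [[B gB] [C' [d' [d'0 Hd']]]]; split.
  exists (A + B) => v; apply: Rle_trans (Rabs_triang _ _) _.
  exact: Rplus_le_compat.
exists (C + C'), (Rmin d d'); split; first exact: Rmin_pos.
move=> e [e0 ed]; have m1 := Rmin_l d d'; have m2 := Rmin_r d d'.
rewrite (@zsum_plus _ A B) //; last lra.
set Z := zsum _ (fun=> 1).
have -> : zsum (theta p + e) f + zsum (theta p + e) g - (mu + nu) * Z =
  (zsum (theta p + e) f - mu * Z) + (zsum (theta p + e) g - nu * Z) by ring.
by apply: Rle_trans (Rabs_triang _ _) _; apply: Rplus_le_compat;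
  [apply: Hd | apply: Hd']; lra.
Qed.

Lemma has_mean_const (a : R) : has_mean (fun=> a) a.
Proof.
apply: (@has_mean_ext (fun=> a * 1)) => [v|]; first ring.
split; first by exists (Rabs (a * 1)) => _; lra.
exists 0, 1; split=> [|e _]; first lra.
by rewrite (zsum_scal _ a (fun=> 1)) Rminus_diag Rabs_R0; lra.
Qed.

Lemma has_mean_rsum (f : nat -> nat -> R) (mu : nat -> R) (n : nat) :
  (forall k, (k < n)%N -> has_mean (f k) (mu k)) ->
  has_mean (fun v => rsum (f^~ v) n) (rsum mu n).
Proof.
elim: n => [|n IH] H /=; first exact: has_mean_const.
apply: (@has_mean_plus (fun v => rsum (f^~ v) n) (f n)); last exact: H.
by apply: IH => k kn; apply: H; exact: ltnW.
Qed.

(* The twisted sums are the real and imaginary parts of the Dirichlet series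
   along the horizontal half-line starting at [theta p - i k zfreq]. *)
Definition tame (k : nat) : Prop :=
  exists M d, 0 < d /\ forall e, 0 < e < d ->
    Rabs (zsum (theta p + e) (fun v => cos (INR k * zfreq * ln (INR v)))) <= M /\
    Rabs (zsum (theta p + e) (fun v => sin (INR k * zfreq * ln (INR v)))) <= M.

Lemma has_mean_cos (k : nat) (b : R) : tame k ->
  has_mean (fun v => cos (INR k * (zfreq * (ln (INR v) - b)))) 0.
Proof.
move=> [M [d [d0 Hd]]].
have Hc : has_mean (fun v => cos (INR k * zfreq * ln (INR v))) 0.
  split; first by exists 1 => v; apply: Rabs_le; exact: COS_bound.
  exists M, d; split=> // e /Hd [H _].
  by rewrite Rmult_0_l Rminus_0_r.
have Hs : has_mean (fun v => sin (INR k * zfreq * ln (INR v))) 0.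
  split; first by exists 1 => v; apply: Rabs_le; exact: SIN_bound.
  exists M, d; split=> // e /Hd [_ H].
  by rewrite Rmult_0_l Rminus_0_r.
have := has_mean_plus (has_mean_scal (cos (INR k * zfreq * b)) Hc)
  (has_mean_scal (sin (INR k * zfreq * b)) Hs).
have -> : cos (INR k * zfreq * b) * 0 + sin (INR k * zfreq * b) * 0 = 0 by ring.
apply: has_mean_ext => v.
have -> : INR k * (zfreq * (ln (INR v) - b)) = INR k * zfreq * ln (INR v) - INR k * zfreq * b by ring.
by rewrite cos_minus; ring.
Qed.

Definition kern (n : nat) (t : R) (v : nat) : R :=
  (cos (zfreq * (ln (INR v) - ln t) / 2) ^ 2) ^ n.

Lemma kern_bound (n : nat) (t : R) (v : nat) : 0 <= kern n t v <= 1.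
Proof.
split; first by apply: pow_le; exact: pow2_ge_0.
rewrite -(pow1 n); apply: pow_incr; split; first exact: pow2_ge_0.
have := COS_bound (zfreq * (ln (INR v) - ln t) / 2); nra.
Qed.

(** In the linearization of [cos^(2n)] every term of nonzero frequency has mean 0 by tameness, so
    only the constant term [k = n] remains. *)
Lemma has_mean_kern (n : nat) (t : R) :
  (forall k, (0 < k)%N -> tame k) -> has_mean (kern n t) (cos_mean n).
Proof.
move=> H.
pose x v := zfreq * (ln (INR v) - ln t) / 2.
pose N := (2 * n)%N.
have Hk k : (k < N.+1)%N -> has_mean
    (fun v => INR 'C(N, k) * cos ((INR N - 2 * INR k) * x v))
    (if k == n then INR 'C(N, n) else 0).
  move=> kN; case: eqP => [->|/eqP kn].
    apply: (has_mean_ext _ (has_mean_const _)) => v.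
    have -> : (INR N - 2 * INR n) * x v = 0 by rewrite /N INR_muln /=; ring.
    by rewrite cos_0; ring.
  rewrite -(Rmult_0_r (INR 'C(N, k))).
  apply: (@has_mean_scal _ (fun v => cos ((INR N - 2 * INR k) * x v))).
  have [nk|nk] := leqP n k.
    apply: (has_mean_ext _ (@has_mean_cos (k - n) (ln t) (H _ _))); last lia.
    move=> v; rewrite -cos_neg; congr cos.
    rewrite /N INR_muln minus_INR /x /=; last by apply/leP.
    field.
  apply: (has_mean_ext _ (@has_mean_cos (n - k) (ln t) (H _ _))); last lia.
  move=> v; congr cos.
  rewrite /N INR_muln minus_INR /x /=; last by apply/leP; exact: ltnW.
  field.
have := has_mean_scal (/ 2 ^ N) (has_mean_rsum Hk).
rewrite rsum_single; last by rewrite /N; lia.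
have -> : / 2 ^ N * INR 'C(N, n) = cos_mean n.
  rewrite /cos_mean /N -multE pow_mult multE.
  have -> : 2 ^ 2 = 4 by ring.
  by rewrite /Rdiv Rmult_comm.
apply: has_mean_ext => v.
by rewrite -cos_pow_linearize /kern -/(x v) /N -multE pow_mult.
Qed.

(** * The shift inequality *)

Let near (k : nat) (x d : R) (v : nat) : R :=
  if Rlt_dec (Rabs (INR v / INR (p ^ k)%N - x)) d then 1 else 0.

Let near_bound (k : nat) (x d : R) (v : nat) : 0 <= near k x d v <= 1.
Proof. by rewrite /near; case: Rlt_dec => ? /=; lra. Qed.

Let INR_expn_p_gt0 (k : nat) : 0 < INR (p ^ k)%N.
Proof. by have := INR_ge1 (expn_p_gt0 k); lra. Qed.

(** The windows at different scales [p ^ k] are disjoint: [3 * d <= x] means [x + d <= 2 * (x - d)],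
    and [p >= 2]. *)
Let near_sum_le1 (x d : R) (v N : nat) : 0 < d -> 3 * d <= x ->
  rsum (fun k => near k x d v) N <= 1.
Proof.
move=> d0 dx; elim: N => [|N IH] /=; first lra.
rewrite {2}/near; case: Rlt_dec => [HN|?] /=; last lra.
rewrite (@rsum_ext _ (fun=> 0)) ?rsum_const; first lra.
move=> k kN; rewrite /near; case: Rlt_dec => //= Hk.
have Pk := INR_expn_p_gt0 k; have PN := INR_expn_p_gt0 N.
have PP : 2 * INR (p ^ k)%N <= INR (p ^ N)%N.
  apply: (@Rle_trans _ (INR (p * p ^ k)%N)).
    by rewrite INR_muln; nra.
  by apply: le_INR; apply/leP; rewrite -expnS leq_exp2l // prime_gt1.
have Ek : INR v = INR v / INR (p ^ k)%N * INR (p ^ k)%N by field; lra.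
have EN : INR v = INR v / INR (p ^ N)%N * INR (p ^ N)%N by field; lra.
move: HN Hk => /Rabs_def2 HN /Rabs_def2 Hk.
nra.
Qed.

(** Dividing by [p ^ k] changes the angle by [k] times [PI], which the squared cosine does not
    see. *)
Let kern_scale (n k v : nat) (t : R) : (0 < v)%N ->
  kern n t v = (cos (zfreq * (ln (INR v / INR (p ^ k)%N) - ln t) / 2) ^ 2) ^ n.
Proof.
move=> v0; rewrite /kern -(cos_sqr_add_INR_PI (zfreq * (ln (INR v / _) - _) / 2) k).
congr ((cos _ ^ 2) ^ n).
have v1 := INR_ge1 v0.
rewrite ln_div; [|lra|exact: INR_expn_p_gt0].
rewrite ln_expn.
have -> : INR k * PI = zfreq * ln (INR p) / 2 * INR k by rewrite zfreq_ln_p; field.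
field.
Qed.

(** The loss [b] bounds [v' / v] on the window, so [v^(- theta p)] is at most
    [b^(theta p) v'^(- theta p)]; the factor [v^(-e)] only grows on passing to [v' <= v]. *)
Let bump_shift (x s d b e : R) (n m k v v' : nat) :
  0 < x -> 0 < d -> 3 * d <= x -> 0 <= s -> 0 < b -> x + d <= b * (x + s - d) ->
  0 < e ->
  (forall y, 0 < y -> Rabs (y - x) < d ->
    (cos (zfreq * (ln (y + s) - ln (x + s)) / 2) ^ 2) ^ n <=
    (cos (zfreq * (ln y - ln x) / 2) ^ 2) ^ m) ->
  INR v = INR v' + s * INR (p ^ k)%N ->
  Rabs (INR v / INR (p ^ k)%N - (x + s)) < d ->
  [/\ (0 < v')%N, near k x d v' = 1 &
   exp (- (theta p + e) * ln (INR v)) * kern n (x + s) v <=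
   Rpower b (theta p) * (exp (- (theta p + e) * ln (INR v')) * kern m x v')].
Proof.
move=> x0 d0 dx s0 b0 Hb e0 Hcos Ev Hd.
have th1 := theta_gt1; have P0 := INR_expn_p_gt0 k.
pose y := INR v' / INR (p ^ k)%N.
have Ey : INR v / INR (p ^ k)%N = y + s by rewrite Ev /y; field; lra.
have Hy : Rabs (y - x) < d.
  by move: Hd; rewrite Ey; have -> : y + s - (x + s) = y - x by ring.
have /Rabs_def2 [Hy1 Hy2] := Hy.
have y0 : 0 < y by lra.
have Ev' : INR v' = y * INR (p ^ k)%N by rewrite /y; field; lra.
have v'0 : (0 < v')%N.
  by apply/ltP; apply: INR_lt; rewrite /= Ev'; nra.
have v0 : (0 < v)%N.
  by apply/ltP; apply: INR_lt; rewrite /= Ev; have := INR_ge1 v'0; nra.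
have V1 := INR_ge1 v0; have V'1 := INR_ge1 v'0.
split=> //; first by rewrite /near -/y; case: Rlt_dec.
have K : kern n (x + s) v <= kern m x v'.
  by rewrite (kern_scale n k _ v0) (kern_scale m k _ v'0) Ey -/y; exact: Hcos.
have [k0 _] := kern_bound n (x + s) v; have [k0' _] := kern_bound m x v'.
rewrite -Rmult_assoc; apply: Rmult_le_compat => //; first exact: Rlt_le (exp_pos _).
rewrite /Rpower -exp_plus; apply: exp_le.
have D0 : ln (INR v') <= ln (INR v) by apply: ln_le; nra.
have Db : ln (INR v') <= ln b + ln (INR v).
  rewrite -ln_mult //; last lra.
  by apply: ln_le; [lra | rewrite Ev Ev'; nra].
nra.
Qed.
Let cos_dominated (x s d : R) (n m : nat) : Prop :=
  forall y, 0 < y -> Rabs (y - x) < d ->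
    (cos (zfreq * (ln (y + s) - ln (x + s)) / 2) ^ 2) ^ n <=
    (cos (zfreq * (ln y - ln x) / 2) ^ 2) ^ m.

(** Each point with [v] near [t P] is charged to the translate given by [Pas_shift], of value near
    [x1 P] or [x2 P]. Rows are widened to a square so that both translations stay inside the range
    of summation. *)
Let near_shift_sum (t x1 x2 d b1 b2 e : R) (n m1 m2 k M : nat) :
  t = x1 + 1 -> t = x2 + h -> 0 < d -> 3 * d <= x1 -> 3 * d <= x2 ->
  t + d <= h + 1 -> 0 < b1 -> 0 < b2 ->
  x1 + d <= b1 * (t - d) -> x2 + d <= b2 * (t - d) -> 0 < e ->
  cos_dominated x1 1 d n m1 -> cos_dominated x2 h d n m2 ->
  rsum (zrow (theta p + e) (fun v => near k t d v * kern n t v)) M <=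
  Rpower b1 (theta p) *
    rsum (zrow (theta p + e) (fun v => near k x1 d v * kern m1 x1 v)) M +
  Rpower b2 (theta p) *
    rsum (zrow (theta p + e) (fun v => near k x2 d v * kern m2 x2 v)) M.
Proof.
move=> t1 t2 d0 dx1 dx2 dt b10 b20 Hb1 Hb2 e0 Hc1 Hc2.
have P0 := expn_p_gt0 k; have PR := INR_expn_p_gt0 k.
set P := (p ^ k)%N in P0 PR *.
have h1 : 1 <= h by exact: INR_ge1.
have x10 : 0 < x1 by lra.
have x20 : 0 < x2 by lra.
pose G b x m i j := Rpower b (theta p) *
  (weight (theta p + e) i j * (near k x d (zval i j) * kern m x (zval i j))).
have G0 b x m i j : 0 <= G b x m i j.
  apply: Rmult_le_pos; first exact: Rlt_le (exp_pos _).
  apply: Rmult_le_pos; first exact: weight_ge0.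
  by apply: Rmult_le_pos; [have := near_bound k x d (zval i j) | have := kern_bound m x (zval i j)]; lra.
have box b x m : rsum (fun i => rsum (G b x m i) M) M = Rpower b (theta p) *
    rsum (zrow (theta p + e) (fun v => near k x d v * kern m x v)) M.
  rewrite -rsum_scal; apply: rsum_ext => i iM.
  by rewrite (zrow_widen _ _ iM) -rsum_scal.
rewrite -!box.
pose G1 i j := if (P <= i)%N then G b1 x1 m1 (i - P)%N j else 0.
pose G2 i j := if (P <= i)%N then (if (P <= j)%N then G b2 x2 m2 (i - P)%N (j - P)%N else 0) else 0.
have shift1 : rsum (fun i => rsum (G1 i) M) M <= rsum (fun i => rsum (G b1 x1 m1 i) M) M.
  apply: Rle_trans (@rsum_shift_le (fun i => rsum (G b1 x1 m1 i) M) P M _); last first.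
    by move=> i; exact: rsum_ge0.
  apply: rsum_le => i _; rewrite /G1; case: ifP => _; first exact: Rle_refl.
  by rewrite rsum_const; lra.
have shift2 : rsum (fun i => rsum (G2 i) M) M <= rsum (fun i => rsum (G b2 x2 m2 i) M) M.
  apply: Rle_trans (@rsum_shift_le (fun i => rsum (G b2 x2 m2 i) M) P M _); last first.
    by move=> i; exact: rsum_ge0.
  apply: rsum_le => i _; rewrite /G2; case: ifP => _; last by rewrite rsum_const; lra.
  exact: rsum_shift_le.
apply: Rle_trans (Rplus_le_compat _ _ _ _ shift1 shift2).
rewrite -rsum_plus; apply: rsum_le => i iM.
rewrite (zrow_widen _ _ iM) -rsum_plus; apply: rsum_le => j jM.
have G1_0 : 0 <= G1 i j by rewrite /G1; case: ifP => _ //; lra.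
have G2_0 : 0 <= G2 i j.
  by rewrite /G2; case: ifP => _; [case: ifP => _ //|]; lra.
set v := zval i j.
have [Hw|Hw] := boolP (Pas p i j && (0 < v)%N); last first.
  by rewrite {1}/weight -/v (negbTE Hw) Rmult_0_l; lra.
have [Hp v0] := andP Hw.
rewrite {1}/near; case: Rlt_dec => [Hd|Hd] /=; last first.
  by rewrite Rmult_0_l Rmult_0_r; lra.
rewrite {1}/weight -/v Hw Rmult_1_l.
have Ev : INR v = INR v / INR P * INR P by field; lra.
(* The window around [t] lies in [[h, h + 1]], since [d <= x2 = t - h] and [t + d <= h + 1]. *)
have HvP : (c.+1 * P <= i + c * j < c.+2 * P)%N.
  have Hd' : Rabs (INR v / INR P - t) < d by [].
  have /Rabs_def2 [K1 K2] := Hd'.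
  have L : h * INR P <= INR v by rewrite Ev; apply: Rmult_le_compat_r; lra.
  have U : INR v < (h + 1) * INR P by rewrite Ev; apply: Rmult_lt_compat_r; lra.
  apply/andP; split; [apply/leP; apply: INR_le | apply/ltP; apply: INR_lt];
    by rewrite INR_muln -/(zval i j) -/v // S_INR.
have [Pi [Hs|[Pj Hs]]] := Pas_shift pr_p c_gt0 Hp HvP.
  have Ev' : INR v = INR (zval (i - P) j) + 1 * INR P.
    by rewrite Rmult_1_l -INR_addn /v /zval; congr INR; lia.
  rewrite t1 in Hd.
  have Hb1' : x1 + d <= b1 * (x1 + 1 - d) by rewrite -t1.
  have [v'0 Hn K] := bump_shift x10 d0 dx1 Rle_0_1
    b10 Hb1' e0 Hc1 Ev' Hd.
  apply: (@Rle_trans _ (G1 i j)); last lra.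
  rewrite t1 /G1 Pi /G /weight Hs v'0 /= Hn Rmult_1_l.
  exact: K.
have Ev' : INR v = INR (zval (i - P) (j - P)) + h * INR P.
  rewrite -INR_muln -INR_addn /v /zval; congr INR; rewrite mulnBr mulSn.
  have : (c * P <= c * j)%N by rewrite leq_mul2l Pj orbT.
  lia.
rewrite t2 in Hd.
have Hb2' : x2 + d <= b2 * (x2 + h - d) by rewrite -t2.
have [v'0 Hn K] := bump_shift x20 d0 dx2
  (Rle_trans _ _ _ Rle_0_1 h1) b20 Hb2' e0 Hc2 Ev' Hd.
apply: (@Rle_trans _ (G2 i j)); last lra.
rewrite t2 /G2 Pi Pj /G /weight Hs v'0 /= Hn Rmult_1_l.
exact: K.
Qed.
(** Rescale [v] by the power of [p] that brings it within half a period of [t]. Either it falls in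
    the window, or [cos_kernel_tail] applies. The indicator absorbs the values below [h + 2], which
    might call for a negative power. *)
Let kern_split (t d : R) : 0 < d -> h <= t - d -> t <= h + 1 ->
  exists2 r, 0 < r < 1 & forall n N v, (0 < v)%N -> (v < c.+1 * p ^ N)%N ->
    kern n t v <= (r ^ n) ^ 2 + indic (v < c.+3)%N +
      rsum (fun k => near k t d v * kern n t v) N.
Proof.
move=> d0 td th.
have h1 : 1 <= h by exact: INR_ge1.
have dt : 0 < d < t by lra.
have [r r01 Hr] := cos_kernel_tail zfreq_gt0 dt.
exists r => // n N v v0 vN.
have [k0 k1] := kern_bound n t v.
have r0 : 0 <= (r ^ n) ^ 2 by exact: pow2_ge_0.
have near0 : 0 <= rsum (fun k => near k t d v * kern n t v) N.
  by apply: rsum_ge0 => k _; apply: Rmult_le_pos => //; have := near_bound k t d v; lra.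
have [vc|cv] := ltnP v c.+3; rewrite /indic; first lra.
have V1 := INR_ge1 v0; have lp := ln_p_gt0.
have tv : t <= INR v.
  have : INR c.+3 <= INR v by apply: le_INR; apply/leP.
  by rewrite 2!S_INR -/h; lra.
have y0 : 0 <= (ln (INR v) - ln t) / ln (INR p) + / 2.
  have : ln t <= ln (INR v) by apply: ln_le; lra.
  move=> H; have : 0 <= (ln (INR v) - ln t) / ln (INR p); last lra.
  by apply: Rmult_le_pos; [lra | apply: Rlt_le; exact: Rinv_0_lt_compat].
(* [k] is a nearest integer to [(ln v - ln t) / ln p], so the angle after rescaling is at most
   [PI / 2] in absolute value. *)
have [k [Hk1 Hk2]] := nfloor_ex _ y0.
have P0 := INR_expn_p_gt0 k.
have x0 : 0 < INR v / INR (p ^ k)%N by apply: Rdiv_lt_0_compat => //; lra.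
have Elx : ln (INR v / INR (p ^ k)%N) = ln (INR v) - INR k * ln (INR p).
  by rewrite ln_div; [rewrite ln_expn | lra | ].
have [near_t|far_t] := Rlt_dec (Rabs (INR v / INR (p ^ k)%N - t)) d; last first.
  have : kern n t v <= (r ^ n) ^ 2; last lra.
  rewrite (kern_scale n k t v0); apply: Hr => //; first lra.
  rewrite Elx.
  have -> : zfreq * (ln (INR v) - INR k * ln (INR p) - ln t) / 2 =
      PI * ((ln (INR v) - ln t) / ln (INR p) - INR k).
    by rewrite /zfreq; field; lra.
  have pi0 := PI_RGT_0.
  rewrite Rabs_mult Rabs_right; last lra.
  rewrite /Rdiv; apply: Rmult_le_compat_l; first lra.
  by apply: Rabs_le; rewrite /Rdiv in Hk1 Hk2; lra.
have kN : (k < N)%N.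
  rewrite -(ltn_exp2l _ _ (prime_gt1 pr_p)); apply/ltP; apply: INR_lt.
  have H : INR v < h * INR (p ^ N)%N.
    by rewrite /h -INR_muln; apply: lt_INR; apply/ltP.
  have Ev : INR v = INR v / INR (p ^ k)%N * INR (p ^ k)%N by field; lra.
  move/Rabs_def2: near_t => [K1 K2].
  have : h * INR (p ^ k)%N <= INR v by rewrite Ev; apply: Rmult_le_compat_r; lra.
  nra.
have := @rsum_ge_term (fun k => near k t d v * kern n t v) k N kN
  (fun k => Rmult_le_pos _ _ (proj1 (near_bound k t d v)) k0).
rewrite {1}/near; case: Rlt_dec => //= _; lra.
Qed.

Lemma zrow_rsum (s : R) (f : nat -> nat -> R) (m N : nat) :
  zrow s (fun v => rsum (f^~ v) N) m = rsum (fun k => zrow s (f k) m) N.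
Proof.
elim: N => [|N IH] /=; last by rewrite zrow_plus IH.
by rewrite /zrow (@rsum_ext _ (fun=> 0)) ?rsum_const => [|n _]; ring.
Qed.

Let small_sum (e : R) (M : nat) : 0 < e ->
  rsum (zrow (theta p + e) (fun v => indic (v < c.+3)%N)) M <=
  INR c.+3 * INR c.+3.
Proof.
move=> e0; have th1 := theta_gt1.
have H0 m : 0 <= zrow (theta p + e) (fun v => indic (v < c.+3)%N) m.
  by apply: zrow_ge0 => v; rewrite /indic; case: ifP => _; lra.
apply: Rle_trans (rsum_incr (leq_addl c.+3 M) H0) _.
rewrite (@rsum_widen _ c.+3) ?leq_addr //; last first.
  move=> m /andP [cm _]; rewrite /zrow (@rsum_ext _ (fun=> 0)) ?rsum_const; first ring.
  move=> n _; rewrite ltnNge (leq_trans cm) ?leq_addr // /indic /=; ring.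
rewrite -rsum_const; apply: rsum_le => m mc.
apply: (@Rle_trans _ (rsum (fun=> 1) m.+1)); last first.
  by rewrite rsum_const Rmult_1_r; apply: le_INR; apply/leP.
apply: rsum_le => n _; rewrite /weight /indic.
case: ifP => [/andP [_ v0]|_]; last by case: ifP => _; lra.
have : exp (- (theta p + e) * ln (INR (zval m n))) <= 1.
  by rewrite -exp_0; apply: exp_le; have := ln_INR_ge0 v0; nra.
have := exp_pos (- (theta p + e) * ln (INR (zval m n))).
by case: ifP => _; lra.
Qed.

Let zsum_ge_rsum (s : R) (f : nat -> R) (M : nat) : theta p < s ->
  (forall v, 0 <= f v <= 1) -> rsum (zrow s f) M <= zsum s f.
Proof.
move=> ths f01; apply: rsum_le_Series.
  by move=> m; apply: zrow_ge0 => v; have := f01 v; lra.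
by apply: (@ex_zrow _ 1) => // v; rewrite Rabs_right; have := f01 v; lra.
Qed.

(** Sum [near_shift_sum] over all scales [k]. On the left the windows capture the kernel up to the
    errors in [kern_split]; on the right they are disjoint, so their total is at most the full
    kernel sum. *)
Let kern_zsum_le (t x1 x2 d b1 b2 : R) :
  t = x1 + 1 -> t = x2 + h -> 0 < d -> 3 * d <= x1 -> 3 * d <= x2 ->
  t + d <= h + 1 -> 0 < b1 -> 0 < b2 ->
  x1 + d <= b1 * (t - d) -> x2 + d <= b2 * (t - d) ->
  exists2 r, 0 < r < 1 & forall (e : R) (n m1 m2 : nat), 0 < e ->
    cos_dominated x1 1 d n m1 -> cos_dominated x2 h d n m2 ->
    zsum (theta p + e) (kern n t) <=
    (r ^ n) ^ 2 * zsum (theta p + e) (fun=> 1) + INR c.+3 * INR c.+3 +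
    Rpower b1 (theta p) * zsum (theta p + e) (kern m1 x1) +
    Rpower b2 (theta p) * zsum (theta p + e) (kern m2 x2).
Proof.
move=> t1 t2 d0 dx1 dx2 dt b10 b20 Hb1 Hb2.
have h1 : 1 <= h by exact: INR_ge1.
have [r r01 Hr] := @kern_split t d d0 ltac:(lra) ltac:(lra).
exists r => // e n m1 m2 e0 Hc1 Hc2.
have ths : theta p < theta p + e by lra.
set s := theta p + e in ths *.
apply: Series_le_bound => [|M].
  by apply: (@ex_zrow _ 1) => // v; rewrite Rabs_right; have := kern_bound n t v; lra.
pose N := M.
have MN : (M <= p ^ N)%N by exact: ltnW (ltn_expl _ (prime_gt1 pr_p)).
have kern0 m : 0 <= zrow s (kern n t) m.
  by apply: zrow_ge0 => v; have := kern_bound n t v; lra.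
apply: Rle_trans (rsum_incr MN kern0) _.
set Q := (p ^ N)%N in MN *.
have rows m : (m < Q)%N -> zrow s (kern n t) m <=
    (r ^ n) ^ 2 * zrow s (fun=> 1) m + zrow s (fun v => indic (v < c.+3)%N) m +
    rsum (fun k => zrow s (fun v => near k t d v * kern n t v) m) N.
  move=> mQ; rewrite -zrow_rsum -(zrow_scal _ _ (fun=> 1)) -!zrow_plus.
  apply: rsum_le => j jm.
  rewrite /weight; case: ifP => [/andP [_ v0]|_]; last lra.
  apply: Rmult_le_compat_l; first exact: Rlt_le (exp_pos _).
  rewrite Rmult_1_r; apply: Hr => //; rewrite /zval mulSn.
  by have : (c * j <= c * m)%N; [rewrite leq_mul2l -ltnS jm orbT | nia].
apply: Rle_trans (rsum_le rows) _.
rewrite 2!rsum_plus rsum_scal rsum_exchange !Rplus_assoc.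
have q1 : 0 <= (r ^ n) ^ 2 by exact: pow2_ge_0.
apply: Rplus_le_compat.
  by apply: Rmult_le_compat_l => //; apply: zsum_ge_rsum => // v; lra.
apply: Rplus_le_compat; first exact: (small_sum Q e0).
apply: Rle_trans (rsum_le (fun k _ => near_shift_sum k Q t1 t2 d0 dx1 dx2 dt b10 b20
  Hb1 Hb2 e0 Hc1 Hc2)) _.
rewrite rsum_plus !rsum_scal.
have fin m x : 3 * d <= x -> rsum (fun k => rsum (zrow s (fun v => near k x d v * kern m x v)) Q) N <=
    zsum s (kern m x).
  move=> dx; rewrite rsum_exchange.
  apply: Rle_trans (zsum_ge_rsum Q ths (kern_bound m x)).
  apply: rsum_le => i _; rewrite -zrow_rsum; apply: zrow_le => v.
  rewrite (@rsum_ext _ (fun k => kern m x v * near k x d v)) => [|k _]; last ring.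
  rewrite rsum_scal; have := near_sum_le1 v N d0 dx; have := kern_bound m x v; nra.
by apply: Rplus_le_compat; apply: Rmult_le_compat_l;
  [exact: Rlt_le (exp_pos _) | exact: fin | exact: Rlt_le (exp_pos _) | exact: fin].
Qed.

(* Dividing by the divergent [zsum (theta p + e) 1] as [e -> 0]. *)
Let cos_mean_ineq (t x1 x2 d b1 b2 : R) :
  (forall k, (0 < k)%N -> tame k) ->
  t = x1 + 1 -> t = x2 + h -> 0 < d -> 3 * d <= x1 -> 3 * d <= x2 ->
  t + d <= h + 1 -> 0 < b1 -> 0 < b2 ->
  x1 + d <= b1 * (t - d) -> x2 + d <= b2 * (t - d) ->
  exists2 r, 0 < r < 1 & forall (n m1 m2 : nat),
    cos_dominated x1 1 d n m1 -> cos_dominated x2 h d n m2 ->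
    cos_mean n <= (r ^ n) ^ 2 +
    Rpower b1 (theta p) * cos_mean m1 + Rpower b2 (theta p) * cos_mean m2.
Proof.
move=> Ht t1 t2 d0 dx1 dx2 dt b10 b20 Hb1 Hb2.
have [r r01 Hr] := kern_zsum_le t1 t2 d0 dx1 dx2 dt b10 b20 Hb1 Hb2.
exists r => // n m1 m2 Hc1 Hc2; apply: Rnot_lt_le => Hlt.
have [_ [C [dd [dd0 HC]]]] := has_mean_kern n t Ht.
have [_ [C1 [d1 [d10 HC1]]]] := has_mean_kern m1 x1 Ht.
have [_ [C2 [d2 [d20 HC2]]]] := has_mean_kern m2 x2 Ht.
set B1 := Rpower b1 _ in Hr Hlt *; set B2 := Rpower b2 _ in Hr Hlt *.
have B10 : 0 < B1 by exact: exp_pos.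
have B20 : 0 < B2 by exact: exp_pos.
pose g := cos_mean n - ((r ^ n) ^ 2 + B1 * cos_mean m1 + B2 * cos_mean m2).
have g0 : 0 < g by rewrite /g; lra.
(* [K] collects all bounded errors. The inequality would give [g * Z <= K], which fails once
   [Z >= (K + 1) / g]. *)
pose K := C + INR c.+3 * INR c.+3 + B1 * C1 + B2 * C2.
have [d3 d30 Hd3] := zsum1_unbounded ((K + 1) / g).
pose e := Rmin (Rmin dd d1) (Rmin d2 d3) / 2.
have l1 := Rmin_l (Rmin dd d1) (Rmin d2 d3); have l2 := Rmin_r (Rmin dd d1) (Rmin d2 d3).
have l3 := Rmin_l dd d1; have l4 := Rmin_r dd d1.
have l5 := Rmin_l d2 d3; have l6 := Rmin_r d2 d3.
have e0 : 0 < e by rewrite /e; have := Rmin_pos _ _ (Rmin_pos _ _ dd0 d10) (Rmin_pos _ _ d20 d30); lra.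
have es : e < Rmin (Rmin dd d1) (Rmin d2 d3) by move: e0; rewrite /e; lra.
clearbody e.
have HZ := Hd3 e ltac:(lra).
have /Rabs_le_between H := HC e ltac:(lra).
have /Rabs_le_between H1 := HC1 e ltac:(lra).
have /Rabs_le_between H2 := HC2 e ltac:(lra).
have HH := Hr e n m1 m2 e0 Hc1 Hc2.
set Z := zsum _ (fun=> 1) in HZ H H1 H2 HH.
have gZ : K + 1 <= g * Z.
  have := Rmult_le_compat_l _ _ _ (Rlt_le _ _ g0) HZ.
  by have -> : g * ((K + 1) / g) = K + 1 by field; lra.
have := Rmult_le_compat_l _ _ _ (Rlt_le _ _ B10) (proj2 H1).
have := Rmult_le_compat_l _ _ _ (Rlt_le _ _ B20) (proj2 H2).
rewrite /g /K in gZ; nra.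
Qed.

(** * Choice of parameters and contradiction *)

Let Rpower_lt1 (x y : R) : 0 < x < 1 -> 0 < y -> Rpower x y < 1.
Proof.
move=> x01 y0; rewrite -[X in _ < X]exp_0; apply: exp_increasing.
have : ln x < ln 1 by apply: ln_increasing; lra.
rewrite ln_1; nra.
Qed.

(** Take [m] to be the integer part of [r^2 N]. The hypothesis reads [N <= l^2 (r^2 N - 1)], so it
    pays for the rounding and [cos_mean_le] applies. *)
Let cos_mean_floor (r l : R) (N : nat) : 0 < r < 1 -> 0 < l ->
  l ^ 2 <= INR N * ((l * r) ^ 2 - 1) ->
  exists2 m, INR m <= r ^ 2 * INR N & cos_mean m <= l * cos_mean N.
Proof.
move=> r01 l0; have n0 := pos_INR N; set n := INR N => Hn.
have nE : n = INR N by [].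
clearbody n; rewrite -nE in n0.
have [m [m1 m2]] := nfloor_ex (r ^ 2 * n) ltac:(nra).
exists m => //.
have l2 : 0 < l ^ 2 by exact: pow_lt.
have nlm : n <= l ^ 2 * INR m.
  have : l ^ 2 * (r ^ 2 * n) <= l ^ 2 * (INR m + 1) by apply: Rmult_le_compat_l; lra.
  by rewrite Rpow_mult_distr in Hn; nra.
have n1 : 0 < n.
  have [//|n1] := Rle_lt_or_eq_dec _ _ n0; rewrite -n1 Rmult_0_l in Hn; lra.
apply: cos_mean_le => //; last by rewrite -nE.
  by apply/leP; apply: INR_le; rewrite -nE; have : r ^ 2 <= 1 by [simpl; nra]; nra.
by apply: Rnot_le_lt => mm; nra.
Qed.

Lemma exists_not_tame : ~ (forall k, (0 < k)%N -> tame k).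
Proof.
move=> Ht; have th1 := theta_gt1.
have h1 : 1 <= h by exact: INR_ge1.
pose al := theta p - 1; have al0 : 0 < al by rewrite /al; lra.
(* [g] bounds [((t - 1) / t)^al] for every [t] up to [h + 1]; [xi = t - h] is then chosen with
   [xi^al = (1 - g) / 2]. *)
pose g := Rpower (h / (h + 1)) al.
have g0 : 0 < g by exact: exp_pos.
have hh : 0 < h / (h + 1) < 1.
  split; first by apply: Rdiv_lt_0_compat; lra.
  by apply: (Rmult_lt_reg_r (h + 1)); [lra | rewrite /Rdiv Rmult_assoc Rinv_l; lra].
have g1 : g < 1 by exact: Rpower_lt1.
pose xi := Rpower ((1 - g) / 2) (/ al).
have xi0 : 0 < xi by exact: exp_pos.
have xi1 : xi < 1 by apply: Rpower_lt1; [lra | exact: Rinv_0_lt_compat].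
have xial : Rpower xi al = (1 - g) / 2.
  by rewrite /xi Rpower_mult Rinv_l ?Rpower_1 //; lra.
pose t := h + xi; pose x1 := h - 1 + xi; pose x2 := xi.
have t1 : t = x1 + 1 by rewrite /t /x1; ring.
have t2 : t = x2 + h by rewrite /t /x2; ring.
have x10 : 0 < x1 by rewrite /x1; lra.
have x20 : 0 < x2 by [].
have t0 : 1 < t by rewrite /t; lra.
pose u1 := x1 / t; pose u2 := x2 / t.
have u1t : u1 * t = x1 by rewrite /u1; field; lra.
have u2t : u2 * t = x2 by rewrite /u2; field; lra.
have u10 : 0 < u1 by apply: Rdiv_lt_0_compat; lra.
have u20 : 0 < u2 by apply: Rdiv_lt_0_compat; lra.
have u11 : u1 < 1 by nra.
have u21 : u2 < 1 by rewrite /x2 in u2t; nra.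
have u1h : u1 <= h / (h + 1).
  have E : u1 = 1 - / t by rewrite /u1 t1; field; lra.
  have -> : h / (h + 1) = 1 - / (h + 1) by field; lra.
  have := Rinv_le_contravar t (h + 1) ltac:(lra) ltac:(rewrite /t; lra); lra.
have u2xi : u2 <= xi by rewrite /x2 in u2t; nra.
(* [E < 1] is the failure of the density inequality at [t]; in fact [E <= (1 + g) / 2]. *)
pose E := Rpower u1 al + Rpower u2 al.
have E0 : 0 < E by apply: Rplus_lt_0_compat; exact: exp_pos.
have E1 : E < 1.
  have := Rle_Rpower_l u1 (h / (h + 1)) al ltac:(lra) (conj u10 u1h).
  have := Rle_Rpower_l u2 xi al ltac:(lra) (conj u20 u2xi).
  rewrite xial -/g /E; lra.
(* [mu > 1] is the slack for all approximations, chosen so that [mu^(theta p + 1) E = sqrt E] is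
   still below 1. *)
pose mu := Rpower E (- / (2 * (theta p + 1))).
have lE : ln E < 0 by rewrite -ln_1; exact: ln_increasing.
have i0 : 0 < / (2 * (theta p + 1)) by apply: Rinv_0_lt_compat; lra.
have mu1 : 1 < mu by rewrite -exp_0; apply: exp_increasing; nra.
have muE : Rpower mu (theta p + 1) * E < 1.
  have -> : Rpower mu (theta p + 1) = Rpower E (- / 2).
    by rewrite /mu Rpower_mult; congr Rpower; field; lra.
  rewrite -{2}(Rpower_1 _ E0) -Rpower_plus; apply: Rpower_lt1; lra.
set F := _ * E in muE.
(* A translation by the ratio [u] costs the weight factor [(u mu)^(theta p)] and the widening factor
   [mu / u]. *)
have bl u : 0 < u -> Rpower (u * mu) (theta p) * (mu / u) =
    Rpower mu (theta p + 1) * Rpower u al.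
  move=> u0; have -> : mu / u = Rpower mu 1 * Rpower u (- 1).
    by rewrite Rpower_Ropp !Rpower_1 //; lra.
  rewrite -Rpower_mult_distr //; last lra.
  have -> : al = theta p + - 1 by [].
  by rewrite !Rpower_plus; ring.
(* [k < 1] leaves the strict margin required by [cos_kernel_compare], while [mu * k = nu > 1] leaves
   the one required by [cos_mean_floor]. *)
pose k := (1 + / mu) / 2.
have imu : 0 < / mu < 1.
  by split; [apply: Rinv_0_lt_compat; lra | rewrite -Rinv_1; apply: Rinv_lt_contravar; lra].
have k01 : 0 < k < 1 by rewrite /k; lra.
have [d1 d10 Hd1] := @cos_kernel_compare zfreq x1 1 (u1 * k) zfreq_gt0 x10 Rle_0_1 ltac:(nra)
  ltac:(rewrite -t1 -/u1; nra).
have [d2 d20 Hd2] := @cos_kernel_compare zfreq x2 h (u2 * k) zfreq_gt0 x20 ltac:(lra) ltac:(nra)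
  ltac:(rewrite -t2 -/u2; nra).
pose b1 := u1 * mu; pose b2 := u2 * mu.
have b10 : 0 < b1 by rewrite /b1; nra.
have b20 : 0 < b2 by rewrite /b2; nra.
(* These solve [x1 + d = b1 * (t - d)] and [x2 + d = b2 * (t - d)] for [d]. *)
pose d3 := x1 * (mu - 1) / (1 + b1); pose d4 := x2 * (mu - 1) / (1 + b2).
have d30 : 0 < d3 by apply: Rdiv_lt_0_compat; nra.
have d40 : 0 < d4 by apply: Rdiv_lt_0_compat; nra.
have [d d0 [dd1 dd2 dx1 dx2 [dxi dd3 dd4]]] : exists2 d, 0 < d &
    [/\ d <= d1, d <= d2, 3 * d <= x1, 3 * d <= x2 & [/\ d <= 1 - xi, d <= d3 & d <= d4]].
  pose a1 := Rmin d1 d2; pose a2 := Rmin (x1 / 3) (x2 / 3).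
  pose a3 := Rmin (1 - xi) (Rmin d3 d4).
  have := Rmin_l d1 d2; have := Rmin_r d1 d2.
  have := Rmin_l (x1 / 3) (x2 / 3); have := Rmin_r (x1 / 3) (x2 / 3).
  have := Rmin_l (1 - xi) (Rmin d3 d4); have := Rmin_r (1 - xi) (Rmin d3 d4).
  have := Rmin_l d3 d4; have := Rmin_r d3 d4.
  have := Rmin_l (Rmin a1 a2) a3; have := Rmin_r (Rmin a1 a2) a3.
  have := Rmin_l a1 a2; have := Rmin_r a1 a2.
  rewrite -/a1 -/a2 -/a3 => *; exists (Rmin (Rmin a1 a2) a3).
    by repeat apply: Rmin_pos; lra.
  by do 2 (split; try lra).
have Hb1 : x1 + d <= b1 * (t - d).
  have : d3 * (1 + b1) = x1 * (mu - 1) by rewrite /d3; field; lra.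
  have : b1 * t = x1 * mu by rewrite /b1 -u1t; ring.
  by nra.
have Hb2 : x2 + d <= b2 * (t - d).
  have : d4 * (1 + b2) = x2 * (mu - 1) by rewrite /d4; field; lra.
  have : b2 * t = x2 * mu by rewrite /b2 -u2t; ring.
  by nra.
have td : t + d <= h + 1 by rewrite /t; lra.
have [r r01 Hr] := cos_mean_ineq Ht t1 t2 d0 dx1 dx2 td b10 b20 Hb1 Hb2.
pose l1 := mu / u1; pose l2 := mu / u2.
have l10 : 0 < l1 by apply: Rdiv_lt_0_compat; lra.
have l20 : 0 < l2 by apply: Rdiv_lt_0_compat; lra.
pose nu := (mu + 1) / 2.
have nu1 : 0 < nu ^ 2 - 1 by rewrite /nu; simpl; nra.
have lk1 : l1 * (u1 * k) = nu by rewrite /l1 /k /nu; field; lra.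
have lk2 : l2 * (u2 * k) = nu by rewrite /l2 /k /nu; field; lra.
pose de := / r - 1.
have de0 : 0 < de.
  have : 1 < / r by rewrite -Rinv_1; apply: Rinv_lt_contravar; lra.
  by rewrite /de; lra.
pose A1 := l1 ^ 2 / (nu ^ 2 - 1); pose A2 := l2 ^ 2 / (nu ^ 2 - 1).
pose A3 := 2 / ((1 - F) * de ^ 2).
have F1 : 0 < (1 - F) * de ^ 2 by apply: Rmult_lt_0_compat; [lra | exact: pow_lt].
have A10 : 0 < A1 by apply: Rdiv_lt_0_compat => //; exact: pow_lt.
have A20 : 0 < A2 by apply: Rdiv_lt_0_compat => //; exact: pow_lt.
have A30 : 0 < A3 by apply: Rdiv_lt_0_compat => //; lra.
(* [A1] and [A2] cover the rounding in [cos_mean_floor], and [A3] the final contradiction. *)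
have [n Hn] := INR_unbounded (A1 + A2 + A3).
have EA1 : A1 * (nu ^ 2 - 1) = l1 ^ 2 by rewrite /A1; field; lra.
have EA2 : A2 * (nu ^ 2 - 1) = l2 ^ 2 by rewrite /A2; field; lra.
have EA3 : A3 * ((1 - F) * de ^ 2) = 2 by rewrite /A3; field; nra.
have [m1 Hm1 am1] := @cos_mean_floor (u1 * k) l1 n ltac:(nra) l10
  ltac:(rewrite lk1; nra).
have [m2 Hm2 am2] := @cos_mean_floor (u2 * k) l2 n ltac:(nra) l20
  ltac:(rewrite lk2; nra).
have Hc1 : cos_dominated x1 1 d n m1.
  by move=> y y0 yd; apply: Hd1 => //; lra.
have Hc2 : cos_dominated x2 h d n m2.
  by move=> y y0 yd; apply: Hd2 => //; lra.
have := Hr n m1 m2 Hc1 Hc2.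
have an := cos_mean_gt0 n.
have B1 := Rmult_le_compat_l _ _ _ (Rlt_le _ _ (exp_pos (theta p * ln b1))) am1.
have B2 := Rmult_le_compat_l _ _ _ (Rlt_le _ _ (exp_pos (theta p * ln b2))) am2.
rewrite -/(Rpower b1 (theta p)) -Rmult_assoc /l1 /b1 bl // in B1.
rewrite -/(Rpower b2 (theta p)) -Rmult_assoc /l2 /b2 bl // in B2.
move=> Hfin.
(* The two bumps account for at most the fraction [F < 1] of the mean. The remainder is too large:
   [cos_mean n >= 1 / (2 n)], while Bernoulli's inequality gives [r^n <= 1 / (n de)]. *)
have K : (1 - F) * cos_mean n <= (r ^ n) ^ 2.
  rewrite /F /E; rewrite -/b1 -/b2 in B1 B2; lra.
have n0 : (0 < n)%N by apply/ltP; apply: INR_lt; rewrite /=; lra.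
have n1 := INR_ge1 n0.
have rn : r ^ n * (1 + INR n * de) <= 1.
  have H := Rfunctions.poly n de de0.
  have E2 : r ^ n * (1 + de) ^ n = 1.
    rewrite -Rpow_mult_distr; have -> : r * (1 + de) = 1 by rewrite /de; field; lra.
    exact: pow1.
  rewrite -[X in _ <= X]E2; apply: Rmult_le_compat_l => //.
  by apply: pow_le; lra.
have rn0 : 0 < r ^ n by apply: pow_lt; lra.
have rn2 : (r ^ n) ^ 2 * (INR n * de) ^ 2 <= 1.
  have nd : 0 <= INR n * de by apply: Rmult_le_pos; lra.
  rewrite -Rpow_mult_distr -[X in _ <= X](pow1 2); apply: pow_incr; split.
    by apply: Rmult_le_pos => //; lra.
  by move: rn; rewrite Rmult_plus_distr_l Rmult_1_r; lra.
clearbody F de; have ag := cos_mean_ge n0.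
have F0 : 0 < 1 - F by lra.
have K2 : 1 - F <= 2 * INR n * (r ^ n) ^ 2.
  have := Rmult_le_compat_l (2 * INR n) _ _ ltac:(lra) K; nra.
have K3 : (1 - F) * (INR n * de) ^ 2 <= 2 * INR n.
  have := Rmult_le_compat_r ((INR n * de) ^ 2) _ _ (pow2_ge_0 _) K2; nra.
have K4 : INR n * ((1 - F) * de ^ 2) <= 2.
  apply: (Rmult_le_reg_l (INR n)); first lra.
  have -> : INR n * (INR n * ((1 - F) * de ^ 2)) = (1 - F) * (INR n * de) ^ 2 by ring.
  lra.
nra.
Qed.
End Zeta.

(** * Complex power series and poles *)

Lemma Re_sum_n (a : nat -> C) (n : nat) :
  Re (sum_n (G := C_AbelianMonoid) a n) = sum_n (fun k => Re (a k)) n.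
Proof. by elim: n => [|n IH]; rewrite ?sum_O // !sum_Sn -IH. Qed.

Lemma Im_sum_n (a : nat -> C) (n : nat) :
  Im (sum_n (G := C_AbelianMonoid) a n) = sum_n (fun k => Im (a k)) n.
Proof. by elim: n => [|n IH]; rewrite ?sum_O // !sum_Sn -IH. Qed.

Lemma is_series_Re_Im (a : nat -> C) (z : C) :
  @is_series C_AbsRing C_NormedModule a z ->
  is_series (fun k => Re (a k)) (Re z) /\ is_series (fun k => Im (a k)) (Im z).
Proof.
move=> H; split.
  apply: (filterlim_ext (fun n => Re (sum_n (G := C_AbelianMonoid) a n))).
    by move=> n; exact: Re_sum_n.
  apply: (filterlim_comp _ _ _ _ _ _ _ _ H).
  exact: (@continuous_fst R_UniformSpace R_UniformSpace).
apply: (filterlim_ext (fun n => Im (sum_n (G := C_AbelianMonoid) a n))).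
  by move=> n; exact: Im_sum_n.
apply: (filterlim_comp _ _ _ _ _ _ _ _ H).
exact: (@continuous_snd R_UniformSpace R_UniformSpace).
Qed.

Lemma is_pseries_Re_Im (a : nat -> C) (t : R) (z : C) :
  @is_pseries C_AbsRing C_NormedModule a (RtoC t) z ->
  is_pseries (fun k => Re (a k)) t (Re z) /\ is_pseries (fun k => Im (a k)) t (Im z).
Proof.
move=> /is_series_Re_Im [H1 H2].
have E k : pow_n (K := C_AbsRing) (RtoC t) k = RtoC (t ^ k).
  elim: k => [//|k IH].
  by rewrite -[LHS]/(RtoC t * pow_n (K := C_AbsRing) (RtoC t) k)%C IH -RtoC_mult.
split; [apply: is_series_ext H1|apply: is_series_ext H2] => k;
  rewrite E pow_n_pow /Re /Im /scal /= /mult /= /Cmult /=; ring.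
Qed.

Lemma C_norm_le (z : C) (A B : R) :
  Rabs (Re z) <= A -> Rabs (Im z) <= B -> Cmod z <= A + B.
Proof.
move=> HA HB; rewrite (surjective_pairing z) -/(Re z) -/(Im z).
have -> : (Re z, Im z) = (RtoC (Re z) + Ci * RtoC (Im z))%C.
  by rewrite /RtoC /Ci /Cplus /Cmult /=; congr pair; ring.
apply: Rle_trans (Cmod_triangle _ _) _.
by rewrite Cmod_mult !Cmod_R Cmod_Ci; lra.
Qed.

Definition bounded_right (f : C -> C) (z0 : C) : Prop :=
  exists M d, 0 < d /\ forall t, 0 < t < d -> Cmod (f (z0 + RtoC t)%C) <= M.

Lemma line_analytic_continuous (u : R -> R) (t0 e : R) :
  line_analytic_at u t0 -> 0 < e ->
  exists2 d, 0 < d & forall t, Rabs t < d -> Rabs (u (t0 + t) - u t0) < e.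
Proof.
move=> [a [r [r0 H]]] e0.
have Hr : Rbar_lt (Rabs 0) (CV_radius a).
  apply: (@Rbar_lt_le_trans _ (Rabs (r / 2))).
    by rewrite Rabs_R0 Rabs_right /=; lra.
  by apply: ex_pseries_radius; exists (u (t0 + r / 2)); apply: H; rewrite Rabs_right; lra.
have [d [d0 Hd]] := PSeries_continuity _ _ Hr e e0.
have m1 := Rmin_l d r; have m2 := Rmin_r d r.
exists (Rmin d r); first exact: Rmin_pos.
move=> t td.
have [->|tn0] := Req_dec t 0; first by rewrite Rplus_0_r Rminus_diag Rabs_R0.
have <- : PSeries a t = u (t0 + t) by apply: is_pseries_unique; apply: H; lra.
have <- : PSeries a 0 = u t0.
  by rewrite -[in RHS](Rplus_0_r t0); apply: is_pseries_unique; apply: H; rewrite Rabs_R0.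
have := Hd t; rewrite /dist /= /R_dist /D_x /no_cond Rminus_0_r; apply; split; last lra.
by split=> //; exact: not_eq_sym.
Qed.

Lemma analytic_bounded_right (g : C -> C) (z0 : C) :
  analytic_at g z0 -> bounded_right g z0.
Proof.
move=> [a [r [r0 H]]].
have Ht t : Rabs t < r ->
    @is_pseries C_AbsRing C_NormedModule a (RtoC t) (g (z0 + RtoC (0 + t))%C).
  move=> tr; have := H (z0 + RtoC t)%C; rewrite Rplus_0_l.
  have -> : (z0 + RtoC t - z0)%C = RtoC t by ring.
  by rewrite Cmod_R; exact.
have A1 : line_analytic_at (fun t => Re (g (z0 + RtoC t)%C)) 0.
  by exists (fun k => Re (a k)), r; split=> // t tr; exact: proj1 (is_pseries_Re_Im (Ht t tr)).
have A2 : line_analytic_at (fun t => Im (g (z0 + RtoC t)%C)) 0.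
  by exists (fun k => Im (a k)), r; split=> // t tr; exact: proj2 (is_pseries_Re_Im (Ht t tr)).
have [d1 d10 H1] := line_analytic_continuous A1 Rlt_0_1.
have [d2 d20 H2] := line_analytic_continuous A2 Rlt_0_1.
set w := g _ in H1 H2.
exists (Rabs (Re w) + 1 + (Rabs (Im w) + 1)), (Rmin d1 d2); split; first exact: Rmin_pos.
move=> t [t0 td]; have := Rmin_l d1 d2; have := Rmin_r d1 d2 => m1 m2.
have ta : Rabs t < Rmin d1 d2 by rewrite Rabs_right; lra.
have := H1 t ltac:(lra); have := H2 t ltac:(lra); rewrite Rplus_0_l => K2 K1.
set v := g _ in K1 K2 *.
have T1 := Rabs_triang (Re v - Re w) (Re w); have T2 := Rabs_triang (Im v - Im w) (Im w).
apply: C_norm_le.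
  by move: T1; have -> : Re v - Re w + Re w = Re v by [ring]; lra.
by move: T2; have -> : Im v - Im w + Im w = Im v by [ring]; lra.
Qed.

(** The head of the power series is [g z0 = 0], so dropping it divides by [z - z0]; at [z0] the
    quotient is given the value [a 1]. *)
Lemma analytic_factor (g : C -> C) (z0 : C) : analytic_at g z0 -> g z0 = 0%C ->
  exists2 g', analytic_at g' z0 &
    forall z, z <> z0 -> g' z = (g z / (z - z0))%C.
Proof.
move=> [a [r [r0 H]]] g0.
pose g' z := if Ceq_dec z z0 then a 1%N else (g z / (z - z0))%C.
exists g'; last by move=> z zz; rewrite /g'; case: Ceq_dec.
have a0 : a 0%N = 0%C.
  have := H z0; have -> : (z0 - z0)%C = 0%C by ring.
  rewrite Cmod_0 g0 => /(_ r0) H0.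
  have H0' := @is_pseries_0 C_AbsRing C_NormedModule a.
  have [E1 E2] := is_pseries_Re_Im H0; have [E1' E2'] := is_pseries_Re_Im H0'.
  rewrite (surjective_pairing (a 0%N)).
  have := is_pseries_unique _ _ _ E1; rewrite (is_pseries_unique _ _ _ E1') => e1.
  have := is_pseries_unique _ _ _ E2; rewrite (is_pseries_unique _ _ _ E2') => e2.
  by move: e1 e2; rewrite /Re /Im => -> ->.
exists (PS_decr_1 a), r; split=> // z zr; rewrite /g'; case: Ceq_dec => [zz|zz] /=.
  rewrite zz.
  have -> : (z0 - z0)%C = 0%C by ring.
  exact: (@is_pseries_0 C_AbsRing C_NormedModule (PS_decr_1 a)).
have zz' : (z - z0)%C <> 0%C.
  by move=> E; apply: zz; have -> : z = (z - z0 + z0)%C by [ring]; rewrite E; ring.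
have := @is_pseries_decr_1 C_AbsRing C_NormedModule a (z - z0)%C (/ (z - z0))%C (g z).
rewrite a0 => /(_ (Cinv_l _ zz') (H z zr)).
have -> // : scal (/ (z - z0))%C (Hierarchy.plus (g z) (Hierarchy.opp (RtoC 0))) = (g z / (z - z0))%C.
rewrite /scal /= /mult /= /Hierarchy.plus /= /Hierarchy.opp /=.
by rewrite Copp_0 Cplus_0_r Cmult_comm.
Qed.

(** Descent on the exponent of the denominator: a numerator that does not vanish at [z0] would make
    a pole, and one that vanishes cancels a factor. At exponent 0 the function is analytic off [z0],
    hence bounded. *)
Lemma not_pole_bounded (f : C -> C) (z0 : C) :
  meromorphic f -> ~ pole f z0 -> bounded_right f z0.
Proof.
move=> /(_ z0) [n [g [Hg Hq]]] np; elim: n g Hg Hq => [|n IH] g Hg Hq.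
  have [M [d [d0 Hd]]] := analytic_bounded_right Hg.
  have [r [r0 Hr]] := Hq.
  exists M, (Rmin d r); split; first exact: Rmin_pos.
  move=> t [t0 td]; have m1 := Rmin_l d r; have m2 := Rmin_r d r.
  rewrite Hr.
  - have -> : (g (z0 + RtoC t) / (z0 + RtoC t - z0) ^ 0)%C = g (z0 + RtoC t)%C.
      by rewrite /=; field.
    by apply: Hd; lra.
  - move=> /(congr1 fst) /=; lra.
  - have -> : (z0 + RtoC t - z0)%C = RtoC t by ring.
    by rewrite Cmod_R Rabs_right; lra.
have [g0|g0] := Ceq_dec (g z0) 0%C; last by case: np; exists n.+1, g.
have [g' Hg' E] := analytic_factor Hg g0.
apply: (IH g') => //.
have [r [r0 Hr]] := Hq; exists r; split=> // z zz zr.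
rewrite (Hr z zz zr) (E z zz) /=.
have zz' : (z - z0)%C <> 0%C.
  by move=> e; apply: zz; have -> : z = (z - z0 + z0)%C by [ring]; rewrite e; ring.
have pz := Cpow_nz _ n zz'.
by field.
Qed.

(** Along a horizontal line the increment [t] is real, so multiplying by [t ^ n] commutes with
    taking real and imaginary parts. *)
Lemma meromorphic_line (f : C -> C) (y t0 : R) : meromorphic f ->
  line_meromorphic_at (fun t => Re (f (t, y))) t0 /\
  line_meromorphic_at (fun t => Im (f (t, y))) t0.
Proof.
move=> /(_ (t0, y)) [n [g [[a [r [r0 Ha]]] [r' [r'0 Hq]]]]].
have m1 := Rmin_l r r'; have m2 := Rmin_r r r'.
have E t : (t0 + t, y) = ((t0, y) + RtoC t)%C.
  by rewrite /RtoC /Cplus /=; congr pair; ring.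
have D t : ((t0, y) + RtoC t - (t0, y))%C = RtoC t by ring.
have H t : t <> 0 -> Rabs t < Rmin r r' ->
    @is_pseries C_AbsRing C_NormedModule a (RtoC t) (RtoC (t ^ n) * f (Rplus t0 t, y))%C.
  move=> tn0 tr; rewrite E.
  have := Ha ((t0, y) + RtoC t)%C; rewrite D Cmod_R => /(_ ltac:(lra)).
  have Ht : RtoC t <> 0%C by move=> /(congr1 fst).
  rewrite (Hq ((t0, y) + RtoC t)%C); last first.
  - by rewrite D Cmod_R; lra.
  - by move=> /(congr1 fst) /=; lra.
  rewrite D RtoC_pow.
  have -> // : (RtoC t ^ n * (g ((t0, y) + RtoC t) / RtoC t ^ n))%C = g ((t0, y) + RtoC t)%C.
  by field; exact: Cpow_nz.
split; exists n; [exists (fun k => Re (a k)) | exists (fun k => Im (a k))];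
  exists (Rmin r r'); (split; first exact: Rmin_pos) => t tn0 tr;
  have [H1 H2] := is_pseries_Re_Im (H t tn0 tr).
- have -> // : t ^ n * Re (f (t0 + t, y)) = Re (RtoC (t ^ n) * f (Rplus t0 t, y))%C.
  by rewrite /Re /=; ring.
- have -> // : t ^ n * Im (f (t0 + t, y)) = Im (RtoC (t ^ n) * f (Rplus t0 t, y))%C.
  by rewrite /Im /=; ring.
Qed.


(** * The zeta function on horizontal lines *)

Section Poles.

Variables (p c : nat) (P : bipoly).
Hypotheses (pr_p : prime p) (c_gt0 : (0 < c)%N).
Hypothesis bievalE : forall m n, bieval P m n = INR (zval c m n).
Hypothesis bidegE : bideg P = 1%N.

Lemma cexp_opp (z : C) : (/ cexp z)%C = cexp (- z)%C.
Proof.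
have e0 := exp_pos (Re z); have sc := sin2_cos2 (Im z); rewrite /Rsqr in sc.
rewrite /cexp /Cinv /Copp /= -/(Re z) -/(Im z) cos_neg sin_neg exp_Ropp.
set x := exp _ in e0 *; set co := cos _ in sc *; set si := sin _ in sc *.
have E : x * co * (x * co * 1) + x * si * (x * si * 1) = x * x.
  by have -> : x * co * (x * co * 1) + x * si * (x * si * 1) =
    x * x * (si * si + co * co) by [ring]; rewrite sc; ring.
by rewrite E; congr pair; field; lra.
Qed.

Lemma zeta_termE (s : C) (m n : nat) :
  zeta_term p P s m n =
  (weight p c (Re s) m n * cos (Im s * ln (INR (zval c m n))),
   - (weight p c (Re s) m n * sin (Im s * ln (INR (zval c m n))))).
Proof.
rewrite /zeta_term bievalE bidegE /weight.
have -> : (INR (zval c m n) != 0)%R = (0 < zval c m n)%N.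
  case: (zval c m n) => [|v]; first by rewrite /= eqxx.
  by apply/eqP; apply: not_0_INR.
case: ifP => [/andP [_ v0]|_]; last by rewrite /RtoC; congr pair; ring.
have v1 := INR_ge1 v0.
rewrite /rcpow cexp_opp /clog; case: Rlt_dec => [v_lt|_] /=; first lra.
rewrite Rabs_right; last lra.
set l := ln _.
have -> : (- (s / RtoC 1 * RtoC l))%C = (- Re s * l, - Im s * l).
  have -> : (s / RtoC 1 = s)%C by field.
  by rewrite /Cmult /Copp /Re /Im /=; congr pair; ring.
rewrite /cexp /=.
have -> : - Im s * l = - (Im s * l) by ring.
by rewrite cos_neg sin_neg; congr pair; ring.
Qed.

Lemma Cmod_zeta_term (s : C) (m n : nat) :
  Cmod (zeta_term p P s m n) = weight p c (Re s) m n.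
Proof.
rewrite zeta_termE /Cmod /=; have w0 := weight_ge0 p c (Re s) m n.
set x := _ * ln _; have sc := sin2_cos2 x; rewrite /Rsqr in sc.
set w := weight _ _ _ _ _ in w0 *.
have -> : w * cos x * (w * cos x * 1) + - (w * sin x) * (- (w * sin x) * 1) = w * w.
  have -> : w * cos x * (w * cos x * 1) + - (w * sin x) * (- (w * sin x) * 1) =
    w * w * (sin x * sin x + cos x * cos x) by ring.
  by rewrite sc; ring.
exact: sqrt_square.
Qed.

Lemma zeta_acvE (s : C) :
  zeta_acv p P s <-> ex_series (zrow p c (Re s) (fun=> 1)).
Proof.
have E m : sum_n (fun n => Cmod (zeta_term p P s m n)) m = zrow p c (Re s) (fun=> 1) m.
  by rewrite sum_n_rsum; apply: rsum_ext => n _; rewrite Cmod_zeta_term; ring.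
by split; apply: ex_series_ext.
Qed.

Lemma abscissaE : abscissa p P = Rbar.Finite (theta p).
Proof.
apply: is_glb_Rbar_unique; split=> [x|b Hb].
  by move=> /zeta_acvE /(ex_zrow1_gt pr_p c_gt0) /= => H; apply: Rlt_le.
have H e : 0 < e -> Rbar_le b (theta p + e).
  by move=> e0; apply: Hb; apply/zeta_acvE; apply: (ex_zrow1 pr_p c_gt0); rewrite /=; lra.
case: b H {Hb} => [b||] H //=; last exact: (H 1 Rlt_0_1).
apply: Rnot_lt_le => bt; have := H ((b - theta p) / 2) ltac:(lra); rewrite /=; lra.
Qed.

Lemma zeta_series_zsum (s z : C) : zeta_series p P s z ->
  Re z = zsum p c (Re s) (fun v => cos (Im s * ln (INR v))) /\
  Im z = - zsum p c (Re s) (fun v => sin (Im s * ln (INR v))).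
Proof.
move=> /is_series_Re_Im [H1 H2]; split.
  rewrite -(is_series_unique _ _ H1); apply: Series_ext => m.
  rewrite Re_sum_n sum_n_rsum; apply: rsum_ext => n _.
  by rewrite zeta_termE.
rewrite -(is_series_unique _ _ H2) -Series_opp; apply: Series_ext => m.
rewrite Im_sum_n sum_n_rsum -[- _]Rmult_1_l Ropp_mult_distr_r_reverse Ropp_mult_distr_l.
rewrite -rsum_scal; apply: rsum_ext => n _.
by rewrite zeta_termE /Im /=; ring.
Qed.

Variable Z : C -> C.
Hypothesis Z_cont : zeta_continuation p P Z.

Lemma zeta_continuation_line (y t : R) : theta p < t ->
  punctured_eq (fun t => Re (Z (t, y)))
    (fun t => zsum p c t (fun v => cos (y * ln (INR v)))) t /\
  punctured_eq (fun t => Im (Z (t, y)))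
    (fun t => - 1 * zsum p c t (fun v => sin (y * ln (INR v)))) t.
Proof.
have [Z_mero [s0 HZ]] := Z_cont; move=> tt.
have Hs x : s0 < x -> Re (Z (x, y)) = zsum p c x (fun v => cos (y * ln (INR v))) /\
    Im (Z (x, y)) = - 1 * zsum p c x (fun v => sin (y * ln (INR v))).
  move=> xs; have [-> ->] := zeta_series_zsum (HZ (x, y) xs).
  by rewrite /=; split=> //; ring.
split.
  apply: (@punctured_eq_continuation _ _ (theta p) s0) => // [x|x xt|x /Hs []] //.
    exact: proj1 (meromorphic_line _ _ Z_mero).
  apply: (zsum_line_analytic pr_p c_gt0 (B := 1)) => // v.
  by apply: Rabs_le; exact: COS_bound.
apply: (@punctured_eq_continuation _ _ (theta p) s0) => // [x|x xt|x /Hs []] //.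
  exact: proj2 (meromorphic_line _ _ Z_mero).
have -> : (fun t => - 1 * zsum p c t (fun v => sin (y * ln (INR v)))) =
    (fun t => zsum p c t (fun v => - 1 * sin (y * ln (INR v)))).
  by apply: FunctionalExtensionality.functional_extensionality => u; rewrite zsum_scal.
apply: (zsum_line_analytic pr_p c_gt0 (B := 1)) => // v.
by rewrite Rabs_mult Rabs_m1 Rmult_1_l; apply: Rabs_le; exact: SIN_bound.
Qed.

(** [Z] and the series may differ at [theta p + e] itself. They agree at a slightly larger abscissa,
    and continuity of the twisted sums brings the bound back at the cost of 1. *)
Lemma not_pole_zsum_bounded (y : R) : ~ pole Z (theta p, y) ->
  exists M d, 0 < d /\ forall e, 0 < e < d ->
    Rabs (zsum p c (theta p + e) (fun v => cos (y * ln (INR v)))) <= M /\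
    Rabs (zsum p c (theta p + e) (fun v => sin (y * ln (INR v)))) <= M.
Proof.
move=> np; have [M [d [d0 HM]]] := not_pole_bounded (proj1 Z_cont) np.
exists (M + 1), d; split=> // e [e0 ed].
have te : theta p < theta p + e by lra.
have [[d1 d10 H1] [d2 d20 H2]] := zeta_continuation_line y te.
have cos1 v : Rabs (cos (y * ln (INR v))) <= 1 by apply: Rabs_le; exact: COS_bound.
have sin1 v : Rabs (sin (y * ln (INR v))) <= 1 by apply: Rabs_le; exact: SIN_bound.
have [d3 d30 H3] := line_analytic_continuous
  (zsum_line_analytic pr_p c_gt0 te cos1) Rlt_0_1.
have [d4 d40 H4] := line_analytic_continuous
  (zsum_line_analytic pr_p c_gt0 te sin1) Rlt_0_1.
have [u u0 [u1 u2 u3 [u4 u5]]] : exists2 u, 0 < u &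
    [/\ u < d1, u < d2, u < d3 & u < d4 /\ u < d - e].
  pose a1 := Rmin d1 d2; pose a2 := Rmin d3 d4.
  have := Rmin_l d1 d2; have := Rmin_r d1 d2.
  have := Rmin_l d3 d4; have := Rmin_r d3 d4.
  have := Rmin_l (Rmin a1 a2) (d - e); have := Rmin_r (Rmin a1 a2) (d - e).
  have := Rmin_l a1 a2; have := Rmin_r a1 a2.
  rewrite -/a1 -/a2 => *.
  have u0 : 0 < Rmin (Rmin a1 a2) (d - e) by repeat apply: Rmin_pos; lra.
  exists (Rmin (Rmin a1 a2) (d - e) / 2); first lra.
  by do 2 (split; try lra).
have ua : Rabs u = u by rewrite Rabs_right; lra.
have un0 : u <> 0 by lra.
have E : Z (theta p + e + u, y) = Z ((theta p, y) + RtoC (e + u))%C.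
  by congr Z; rewrite /RtoC /Cplus /=; congr pair; ring.
have HZ := HM (e + u) ltac:(lra); rewrite -E in HZ.
have Zre := Rle_trans _ _ _ (re_le_Cmod _) HZ.
have Zim : Rabs (Im (Z (theta p + e + u, y))) <= M :=
  Rle_trans _ _ _ (Rle_trans _ _ _ (Rmax_r _ _) (Rmax_Cmod _)) HZ.
have := H3 u; have := H4 u; rewrite ua => /(_ u4) K4 /(_ u3) K3.
have := H1 u un0; have := H2 u un0; rewrite ua => /(_ u2) E2 /(_ u1) E1.
rewrite E1 in Zre; rewrite E2 Rabs_mult Rabs_m1 Rmult_1_l in Zim.
have close x x' : Rabs (x' - x) < 1 -> Rabs x' <= M -> Rabs x <= M + 1.
  move=> xx x'M; have := Rabs_triang (x - x') x'; have := Rabs_minus_sym x x'.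
  by have -> : x - x' + x' = x by [ring]; lra.
by split; [exact: close K3 Zre | exact: close K4 Zim].
Qed.

(** Changing the sign of [y] fixes the cosine sum and negates the sine sum, so one frequency that is
    not tame yields poles at both ordinates [y] and [- y]. *)
Lemma exists_nonreal_poles : exists s1 s2 : C,
  [/\ s1 <> s2,
      [/\ pole Z s1, nonreal s1 & on_axis p P s1]
    & [/\ pole Z s2, nonreal s2 & on_axis p P s2]].
Proof.
have [k k0 nt] : exists2 k, (0 < k)%N & ~ tame p c k.
  apply: Classical_Prop.NNPP => H; apply: (exists_not_tame pr_p c_gt0) => k k0.
  by apply: Classical_Prop.NNPP => nt; apply: H; exists k.
pose y := INR k * zfreq p.
have y0 : 0 < y.
  apply: Rmult_lt_0_compat; last exact: (zfreq_gt0 pr_p c_gt0).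
  by have := INR_ge1 k0; lra.
exists (theta p, y), (theta p, - y); split.
- by move=> /(congr1 snd) /=; lra.
- split; [|by rewrite /nonreal /=; lra|by rewrite /on_axis abscissaE].
  by apply: Classical_Prop.NNPP => /not_pole_zsum_bounded.
split; [|by rewrite /nonreal /=; lra|by rewrite /on_axis abscissaE].
apply: Classical_Prop.NNPP => /not_pole_zsum_bounded [M [d [d0 H]]].
apply: nt; exists M, d; split=> // e /H [Hc Hs].
split.
  rewrite (zsum_ext _ _ _ (g := fun v => cos (- y * ln (INR v)))) // => v.
  by rewrite Ropp_mult_distr_l_reverse cos_neg.
rewrite (zsum_ext _ _ _ (g := fun v => - 1 * sin (- y * ln (INR v)))).
  by rewrite zsum_scal Rabs_mult Rabs_m1 Rmult_1_l.
by move=> v; rewrite Ropp_mult_distr_l_reverse sin_neg -/y; ring.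
Qed.

End Poles.

(** * Degree and values of the linear polynomials *)

Section Polynomials.
Import GRing.Theory mpoly.
Local Open Scope ring_scope.

Lemma bideg_linear (a : R) :
  bideg ('X_(ord0 : 'I_2) + a *: 'X_(ord_max : 'I_2)) = 1%N.
Proof.
rewrite /bideg; set Q := _ + _.
have H1 : (msize Q <= 2)%N.
  apply: leq_trans (msizeD_le _ _) _; rewrite geq_max msizeX mdeg1 leqnn /=.
  by apply: leq_trans (msizeZ_le _ _) _; rewrite msizeX mdeg1.
have H2 : (1 < msize Q)%N.
  rewrite -[X in (X < _)%N](mdeg1 (ord0 : 'I_2)); apply: msize_mdeg_lt.
  rewrite mcoeff_msupp mcoeffD mcoeffZ !mcoeffXU eqxx /= mulr0 addr0.
  exact: oner_neq0.
by move: H1 H2; case: (msize Q) => [|[|[|k]]].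
Qed.

Lemma bieval_linear (a : R) (m n : nat) :
  bieval ('X_(ord0 : 'I_2) + a *: 'X_(ord_max : 'I_2)) m n =
  (INR m + a * INR n)%coqR.
Proof. by rewrite /bieval mevalD mevalZ !mevalXU. Qed.

Lemma X_add_YE : X_add_Y = 'X_(ord0 : 'I_2) + 1 *: 'X_(ord_max : 'I_2).
Proof. by rewrite scale1r. Qed.

End Polynomials.

Local Close Scope R_scope.

Theorem theorem1p2 :
  (forall p : nat, prime p ->
     abscissa p X_add_Y = Rbar.Finite (theta p) /\
     forall Z : C -> C, zeta_continuation p X_add_Y Z ->
       exists s1 s2 : C,
         [/\ s1 <> s2,
             [/\ pole Z s1, nonreal s1 & on_axis p X_add_Y s1]
           & [/\ pole Z s2, nonreal s2 & on_axis p X_add_Y s2]]) /\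
  (abscissa 2 X_add_2Y = Rbar.Finite (theta 2) /\
   forall Z : C -> C, zeta_continuation 2 X_add_2Y Z ->
     exists s1 s2 : C,
       [/\ s1 <> s2,
           [/\ pole Z s1, nonreal s1 & on_axis 2 X_add_2Y s1]
         & [/\ pole Z s2, nonreal s2 & on_axis 2 X_add_2Y s2]]).
Proof.
have val1 m n : bieval X_add_Y m n = INR (zval 1 m n).
  by rewrite X_add_YE bieval_linear /zval INR_addn INR_muln.
have val2 m n : bieval X_add_2Y m n = INR (zval 2 m n).
  by rewrite bieval_linear /zval INR_addn INR_muln.
have deg1 : bideg X_add_Y = 1%N by rewrite X_add_YE; exact: bideg_linear.
have deg2 : bideg X_add_2Y = 1%N by exact: bideg_linear.
split=> [p pr_p|]; split.
- exact: (abscissaE pr_p _ val1 deg1).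
- by move=> Z; exact: (exists_nonreal_poles pr_p _ val1 deg1).
- exact: (abscissaE _ _ val2 deg2).
- by move=> Z; exact: (exists_nonreal_poles _ _ val2 deg2).
Qed.
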